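(* Let $t_0>0$ and let $Y_t^{t_0}=A_{E_{t+t_0}}-A_{E_{t_0}}$, $t\ge 0$, be the aging process of $Y_t=A_{E_t}$. Let $k\ge 1$ and let $B_1,B_2,\ldots,B_k\subseteq\mathbb{R}$ be Borel sets such that $0\notin B_1$. Let $$p_{t_0}(r)=\frac{\left(\frac{r}{t_0}\right)^{-\alpha}\left(1+\frac{r}{t_0}\right)^{-1}}{t_0\, B[1-\alpha,\alpha]},\qquad r>0.$$ Then for all $0<t_1<t_2<\cdots<t_k$, $$P\left(Y_{t_1}^{t_0}\in B_1,Y_{t_2}^{t_0}\in B_2,\ldots,Y_{t_k}^{t_0}\in B_k\right)=\int_0^{t_1}P\left(Y_{t_1-r}\in B_1,Y_{t_2-r}\in B_2,\ldots,Y_{t_k-r}\in B_k\right)p_{t_0}(r)\,dr.$$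
   Context: Let $0<\alpha<1$ and $c>0$. $(A_t)_{t\ge0}$ is a real-valued Lévy process with $A_0=0$. $(D_t)_{t\ge 0}$ is a stable subordinator of index $\alpha$ with $D_0=0$ and $E(e^{-uD_t})=e^{-tcu^{\alpha}}$ for $u\ge 0$, independent of $(A_t)$. Its inverse is $E_t=\inf\{s: D_s>t\}$, and $Y_t=A_{E_t}$. $B[\mu,\nu]=\frac{\Gamma(\mu)\Gamma(\nu)}{\Gamma(\mu+\nu)}$ is the Beta function. The function $p_{t_0}$ is the density of the generalized beta prime distribution $f(x,\mu,\nu,h)=\frac{(x/h)^{\mu-1}(1+x/h)^{-\mu-\nu}}{h\,B[\mu,\nu]}$, $x>0$, with parameters $\mu=1-\alpha$, $\nu=\alpha$, $h=t_0$. *)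

(* Defs.v *)
From HB Require Import structures.
From mathcomp Require Import all_boot all_order all_algebra.
From mathcomp Require Import all_classical all_reals all_analysis.

Set Implicit Arguments.
Unset Strict Implicit.
Unset Printing Implicit Defensive.

Import Order.TTheory GRing.Theory Num.Theory.
Import numFieldNormedType.Exports.

Local Open Scope classical_set_scope.
Local Open Scope ring_scope.

(* MathComp-Analysis.  A process with time set [0, +oo[ is a family
   X : R -> {RV P >-> R}; everything below only looks at indices t >= 0, so
   the variables attached to t < 0 are arbitrary and irrelevant. *)

Section processes.
Context {d : measure_display} {T : measurableType d} {R : realType}.
Variable P : probability T R.

Definition cadlag (f : R -> R) : Prop :=
  (forall t, 0 <= t -> f s @[s --> t^'+] --> f t) /\
  (forall t, 0 < t -> cvg (f s @[s --> t^'-])).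

(* Letting some of the B i be setT shows that the product rule for full
   families of increments contains the one for subfamilies. *)
Definition independent_increments (X : R -> {RV P >-> R}) : Prop :=
  forall (n : nat) (t : nat -> R) (B : nat -> set (measurableTypeR R)),
    0 <= t 0%N -> (forall i, (i < n)%N -> t i <= t i.+1) ->
    (forall i, measurable (B i)) ->
    P [set w | forall i, (i < n)%N -> B i (X (t i.+1) w - X (t i) w)] =
    (\prod_(i < n) P [set w | B i (X (t i.+1) w - X (t i) w)%R])%E.

Definition stationary_increments (X : R -> {RV P >-> R}) : Prop :=
  forall (s h : R) (B : set (measurableTypeR R)),
    0 <= s -> 0 <= h -> measurable B ->
    P [set w | B (X (s + h) w - X s w)] = P [set w | B (X h w - X 0 w)].

Definition stochastically_continuous (X : R -> {RV P >-> R}) : Prop :=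
  forall t e : R, 0 <= t -> 0 < e ->
    P [set w | e < `|X s w - X t w|]
      @[s --> within [set s | 0 <= s] (nbhs t)] --> 0%E.

(* All paths (not only almost all of them) are cadlag, so that a process
   evaluated at a random time is again a random variable, even when P is not
   complete. *)
Record levy_process (X : R -> {RV P >-> R}) : Prop := LevyProcess {
  levy_start : {ae P, forall w, X 0 w = 0};
  levy_independent : independent_increments X;
  levy_stationary : stationary_increments X;
  levy_continuous : stochastically_continuous X;
  levy_cadlag : forall w, cadlag (X ^~ w) }.

Record stable_subordinator (alpha c : R) (D : R -> {RV P >-> R}) : Prop :=
  StableSubordinator {
  stable_levy : levy_process D;
  stable_nondecreasing :
    {ae P, forall w, forall s t, 0 <= s -> s <= t -> D s w <= D t w};
  stable_laplace : forall t u, 0 <= t -> 0 <= u ->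
    'E_P[fun w => expR (- (u * D t w))%R]%E = (expR (- (t * c * u `^ alpha)))%:E }.

Definition process_sigma_algebra (X : R -> {RV P >-> R}) : set (set T) :=
  <<s [set C | exists t, exists B : set (measurableTypeR R),
         [/\ 0 <= t, measurable B & C = X t @^-1` B]] >>.

Definition independent_processes (X Z : R -> {RV P >-> R}) : Prop :=
  forall C C', process_sigma_algebra X C -> process_sigma_algebra Z C' ->
    P (C `&` C') = (P C * P C')%E.

(* inf set0 = 0: the value on the event that the path of D stays below t,
   which is P-negligible for a stable subordinator. *)
Definition inverse_subordinator (D : R -> {RV P >-> R}) (t : R) (w : T) : R :=
  inf [set s | 0 <= s /\ t < D s w].

Definition time_changed (A D : R -> {RV P >-> R}) (t : R) (w : T) : R :=
  A (inverse_subordinator D t w) w.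

Definition aging (Y : R -> T -> R) (t0 t : R) (w : T) : R :=
  Y (t + t0) w - Y t0 w.

End processes.

Section beta_prime.
Context {R : realType}.

(* Euler's integral: the usual values for a > 0 and for a, b > 0. *)
Definition gamma_function (a : R) : R :=
  \int[lebesgue_measure]_(x in `]0, +oo[) (x `^ (a - 1) * expR (- x)).

Definition beta_function (a b : R) : R :=
  gamma_function a * gamma_function b / gamma_function (a + b).

Definition aging_density (alpha t0 r : R) : R :=
  (r / t0) `^ (- alpha) * (1 + r / t0)^-1 /
  (t0 * beta_function (1 - alpha) alpha).

End beta_prime.

(* Main.v *)
Require Import Defs.
From HB Require Import structures.
From mathcomp Require Import all_boot all_order all_algebra.
From mathcomp Require Import all_classical all_reals all_analysis.
From mathcomp Require Import measurable_realfun ring lra.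

Set Implicit Arguments.
Unset Strict Implicit.
Unset Printing Implicit Defensive.

Import Order.TTheory GRing.Theory Num.Theory.
Import numFieldNormedType.Exports.

Local Open Scope classical_set_scope.
Local Open Scope ring_scope.

(* Let E be the first passage time of D above t0 and H = D_E - t0 the overshoot.
   By the strong Markov property the pair (A, D), restarted at E, is independent
   of H and distributed as (A, D). The aging process vanishes before time H, and
   Y_{t + t0} - Y_{t0} is, for t >= H, the value at t - H of the process Y built
   from the restarted pair. As 0 is not in B_1, the event forces H <= t_1, and
   Fubini's theorem reduces the claim to: H has density p_{t0}.

   The strong Markov property holds on the grids of mesh 1/(n+1), where it is a
   consequence of independent stationary increments, and passes to the limit by
   right continuity. Applied to the Laplace transform, it gives, for q > 0,
     int_0^oo E[e^(-q D_s) ; D_s > t0] ds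
       = e^(-q t0) E[e^(-q H)] E[int_0^oo e^(-q D_s) ds].
   The potential measure of D has Laplace transform 1 / (c q^alpha), hence density
   x^(alpha - 1) / (c Gamma(alpha)), so this formula determines E[e^(-q H)], which
   is seen to be the Laplace transform of p_{t0}. *)

(** * Laws of families of random variables *)

(** The strong Markov property is an equality of laws of families of real variables: the index
    [None] carries H, the other indices the two components of the restarted pair. Such families live
    on the space of all functions on the index set, without any regularity, so each functional
    applied to the restarted path has to be measurable on arbitrary paths. This is why the inverse
    and the time change are redefined from values on countable grids and identified with the true
    ones only on right-continuous paths.

    Laplace transforms are never inverted. For X >= 0, the transform at q + n is the n-th moment of
    e^(-X), which lies in [0, 1], under the weight e^(-q X). Equal moments give equal weighted
    tails, by explicit polynomials tending to an indicator. The weight admits the potential measure,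
    whose mass is infinite.

    The constants agree because c cancels between the two evaluations of the integral, and the
    substitution x = t_0 + v / q turns the transform of p_{t_0} into the integral of x^(alpha - 1)
    e^(-q (x - t_0)) over x > t_0, up to a constant factor. *)

Section cylinders.
Context {R : realType} {I : Type}.
Implicit Types (s : seq (I * R)) (S : set (I -> R)).

(** A list may constrain the same coordinate several times, so that concatenation of lists is
    intersection of orthants. *)
Definition orthant s : set (I -> R) := [set v | all (fun p => p.2 < v p.1) s].

Definition cylinders : set (set (I -> R)) := range orthant.

Lemma setI_closed_cylinders : setI_closed cylinders.
Proof.
move=> _ _ [s _ <-] [s' _ <-]; exists (s ++ s') => //.
by apply/seteqP; split=> v; rewrite /orthant /= all_cat => /andP.
Qed.

Lemma orthant_cons p s :
  orthant (p :: s) = [set v | p.2 < v p.1] `&` orthant s.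
Proof. by apply/seteqP; split=> v; rewrite /orthant /= => /andP. Qed.

Context d (T : measurableType d) (Z : T -> I -> R).
Hypothesis mZ : forall i, measurable_fun setT (Z ^~ i).

Lemma measurable_preimage_orthant s : measurable (Z @^-1` orthant s).
Proof.
elim: s => [|p s IHs].
  by rewrite (_ : _ @^-1` _ = setT) //; apply/seteqP; split.
rewrite orthant_cons preimage_setI; apply: measurableI => //.
rewrite (_ : _ @^-1` _ = setT `&` (Z ^~ p.1) @^-1` `]p.2, +oo[%classic).
  by apply: mZ => //; exact: measurable_itv.
by apply/seteqP; split=> w /=; rewrite in_itv /= andbT => // -[].
Qed.

Lemma measurable_family :
  measurable_fun setT (Z : T -> g_sigma_algebraType cylinders).
Proof.
apply: (@measurability _ _ T (g_sigma_algebraType cylinders) setT Z cylinders) => //.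
move=> _ [_ [s _ <-] <-].
by rewrite setTI; exact: measurable_preimage_orthant.
Qed.

Lemma measurable_preimage_cylinders S : <<s cylinders >> S ->
  measurable (Z @^-1` S).
Proof. by move=> mS; rewrite -[X in measurable X]setTI; exact: measurable_family. Qed.

End cylinders.

Section family_law.
Local Open Scope ereal_scope.
Context {R : realType} {I : Type}.
Context d1 (T1 : measurableType d1) (P1 : probability T1 R).
Context d2 (T2 : measurableType d2) (P2 : probability T2 R).
Variables (Z1 : T1 -> I -> R) (Z2 : T2 -> I -> R).
Hypothesis mZ1 : forall i, measurable_fun setT (Z1 ^~ i).
Hypothesis mZ2 : forall i, measurable_fun setT (Z2 ^~ i).

(** The orthants are closed under intersection, contain the whole space (empty list) and generate,
    so a probability is determined by its values on them. *)
Lemma family_law_unique :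
  (forall s, P1 (Z1 @^-1` orthant s) = P2 (Z2 @^-1` orthant s)) ->
  forall S, <<s cylinders >> S -> P1 (Z1 @^-1` S) = P2 (Z2 @^-1` S).
Proof.
move=> P12 S mS.
pose W : measurableType _ := g_sigma_algebraType (@cylinders R I).
rewrite -[LHS]/(pushforward P1 (Z1 : T1 -> W) S).
rewrite -[RHS]/(pushforward P2 (Z2 : T2 -> W) S).
apply: (@measure_unique _ _ W cylinders (fun=> setT)) => //.
- exact: setI_closed_cylinders.
- by move=> _; exists [::] => //; apply/seteqP; split.
- by apply/seteqP; split=> // x _; exists 0%N.
- exact: measurable_family.
- exact: measurable_family.
- by move=> mf1 mf2 _ [s _ <-]; exact: P12.
- by move=> mf1 _; rewrite /= /pushforward preimage_setT probability_setT ltry.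
Qed.

Lemma family_law_integral (f : g_sigma_algebraType (@cylinders R I) -> \bar R) :
  (forall S, <<s cylinders >> S -> P1 (Z1 @^-1` S) = P2 (Z2 @^-1` S)) ->
  measurable_fun setT f ->
  (forall v, 0 <= f v) ->
  \int[P1]_w f (Z1 w) = \int[P2]_w f (Z2 w).
Proof.
move=> P12 mf f0.
pose W : measurableType _ := g_sigma_algebraType (@cylinders R I).
have mW1 : measurable_fun setT (Z1 : T1 -> W) by exact: measurable_family.
have mW2 : measurable_fun setT (Z2 : T2 -> W) by exact: measurable_family.
have := @ge0_integral_pushforward _ _ _ _ _ _ mW1 P1 setT f measurableT mf
  (fun v _ => f0 v).
have := @ge0_integral_pushforward _ _ _ _ _ _ mW2 P2 setT f measurableT mf
  (fun v _ => f0 v).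
rewrite !preimage_setT => <- <-.
by apply: eq_measure_integral => A mA _; exact: P12.
Qed.

End family_law.

Lemma measurable_coordinate {R : realType} {I : Type} (i : I) :
  measurable_fun setT
    (fun v : g_sigma_algebraType (@cylinders R I) => v i).
Proof.
apply: (measurability (@RGenOInfty.G R)) => //.
  exact: RGenOInfty.measurableE.
move=> _ [_ [a ->] <-]; rewrite setTI; apply: sub_sigma_algebra.
by exists [:: (i, a)].
Qed.

(** * Continuous approximations of indicators of orthants *)

Section ramp.
Context {R : realType}.

(** Continuous in x and tending to the indicator of x > a as k grows. Limits of variables may be
    taken inside it, unlike inside the indicator. *)
Definition ramp (k : nat) (a x : R) : R :=
  Num.min 1 (k%:R * Num.max 0 (x - a)).

Lemma ramp_ge0 k a x : 0 <= ramp k a x.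
Proof. by rewrite le_min ler01 mulr_ge0 // le_max lexx. Qed.

Lemma ramp_le1 k a x : ramp k a x <= 1.
Proof. by rewrite ge_min lexx. Qed.

Lemma continuous_ramp k a : continuous (ramp k a).
Proof.
move=> x.
apply: (@continuous_min R R (fun=> 1) (fun y => k%:R * Num.max 0 (y - a))).
  exact: cvg_cst.
apply: cvgM; first exact: cvg_cst.
apply: (@continuous_max R R (fun=> 0) (fun y => y - a)); first exact: cvg_cst.
by apply: cvgB; [exact: cvg_id | exact: cvg_cst].
Qed.

Lemma cvg_ramp a x : ramp k a x @[k --> \oo] --> ((a < x)%R%:R : R).
Proof.
have [ax|xa] := ltP a x; last first.
  under eq_fun do rewrite /ramp max_l ?subr_le0 // mulr0 min_r //.
  exact: cvg_cst.
apply: cvg_near_cst; near=> k; rewrite /ramp max_r ?subr_ge0 ?(ltW ax) //.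
apply: min_l; rewrite -ler_pdivrMr ?subr_gt0 // mul1r ltW //.
by near: k; exact: nbhs_infty_gtr.
Unshelve. all: by end_near. Qed.

Context {I : Type}.
Implicit Types (s : seq (I * R)) (v : I -> R).

Definition ramps k s v : R := \prod_(p <- s) ramp k p.2 (v p.1).

Lemma ramps_ge0 k s v : 0 <= ramps k s v.
Proof. by apply: prodr_ge0 => p _; exact: ramp_ge0. Qed.

Lemma ramps_le1 k s v : ramps k s v <= 1.
Proof.
rewrite /ramps; elim: s => [|p s IHs]; first by rewrite big_nil.
rewrite big_cons mulr_ile1 ?ramp_ge0 ?ramp_le1 //; exact: ramps_ge0.
Qed.

Lemma cvg_ramps_orthant s v : ramps k s v @[k --> \oo] --> (\1_(orthant s) v : R).
Proof.
elim: s => [|p s IHs].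
  under eq_fun do rewrite /ramps big_nil.
  rewrite (_ : \1__ v = 1); first exact: cvg_cst.
  by rewrite indicE mem_set.
under eq_fun do rewrite /ramps big_cons.
have -> : \1_(orthant (p :: s)) v =
    (p.2 < v p.1)%R%:R * \1_(orthant s) v :> R.
  by rewrite orthant_cons indicI /= [in LHS]indicE mem_setE.
by apply: cvgM => //; exact: cvg_ramp.
Qed.

Lemma cvg_ramps k s (v_ : nat -> I -> R) v :
  (forall i, v_ n i @[n --> \oo] --> v i) ->
  ramps k s (v_ n) @[n --> \oo] --> ramps k s v.
Proof.
move=> v_v; rewrite /ramps; elim: s => [|p s IHs].
  under eq_fun do rewrite big_nil.
  by rewrite big_nil; exact: cvg_cst.
under eq_fun do rewrite big_cons.
rewrite big_cons; apply: cvgM => //.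
apply: continuous_cvg; first exact: continuous_ramp.
exact: v_v.
Qed.

Lemma measurable_ramps d (T : measurableType d) (Z : T -> I -> R) k s :
  (forall i, measurable_fun setT (Z ^~ i)) ->
  measurable_fun setT (fun w => ramps k s (Z w)).
Proof.
move=> mZ; rewrite /ramps; elim: s => [|p s IHs].
  by under eq_fun do rewrite big_nil; exact: measurable_cst.
under eq_fun do rewrite big_cons.
apply: measurable_funM => //; apply: measurableT_comp => //.
apply: continuous_measurable_fun; exact: continuous_ramp.
Qed.

End ramp.

(** * Equality in law under almost sure convergence *)

Section family_law_cvg.
Local Open Scope ereal_scope.
Context {R : realType} {I : Type}.

Lemma bounded_cvg_integral d (T : measurableType d) (P : probability T R)
    (f_ : nat -> T -> R) (f : T -> R) :
  (forall n, measurable_fun setT (f_ n)) -> measurable_fun setT f ->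
  (forall n w, (0 <= f_ n w <= 1)%R) ->
  {ae P, forall w, f_ n w @[n --> \oo] --> f w} ->
  \int[P]_w (f_ n w)%:E @[n --> \oo] --> \int[P]_w (f w)%:E.
Proof.
move=> mf_ mf f_01 f_f.
have [] := @dominated_convergence _ _ _ P setT measurableT
  (fun n => EFin \o f_ n) (EFin \o f) (cst 1).
- by move=> n; exact/measurable_EFinP.
- exact/measurable_EFinP.
- by apply: filterS f_f => w f_fw _; apply: cvg_EFin => //; near=> n.
- exact: finite_measure_integrable_cst.
- apply/aeW => w n _; have /andP[f0 f1] := f_01 n w.
  by rewrite /= lee_fin ger0_norm.
- by [].
Unshelve. all: by end_near. Qed.

Context d1 (T1 : measurableType d1) (P1 : probability T1 R).
Context d2 (T2 : measurableType d2) (P2 : probability T2 R).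

(** Probabilities of orthants need not converge along the sequence, so two limits are taken in
    order: n to infinity for a fixed product of ramps, then k to infinity to recover the orthant.
    Both are dominated by 1. *)
Lemma family_law_cvg (Y1 : nat -> T1 -> I -> R) (Y2 : nat -> T2 -> I -> R)
    (Z1 : T1 -> I -> R) (Z2 : T2 -> I -> R) :
  (forall n i, measurable_fun setT (Y1 n ^~ i)) ->
  (forall n i, measurable_fun setT (Y2 n ^~ i)) ->
  (forall i, measurable_fun setT (Z1 ^~ i)) ->
  (forall i, measurable_fun setT (Z2 ^~ i)) ->
  {ae P1, forall w, forall i, Y1 n w i @[n --> \oo] --> Z1 w i} ->
  {ae P2, forall w, forall i, Y2 n w i @[n --> \oo] --> Z2 w i} ->
  (forall n s, P1 (Y1 n @^-1` orthant s) = P2 (Y2 n @^-1` orthant s)) ->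
  forall S, <<s cylinders >> S -> P1 (Z1 @^-1` S) = P2 (Z2 @^-1` S).
Proof.
move=> mY1 mY2 mZ1 mZ2 YZ1 YZ2 Y12; apply: family_law_unique => // s.
have orthantE d (T : measurableType d) (P : probability T R) (Z : T -> I -> R) :
    (forall i, measurable_fun setT (Z ^~ i)) ->
    \int[P]_w (ramps k s (Z w))%:E @[k --> \oo] --> P (Z @^-1` orthant s).
  move=> mZ; have -> : P (Z @^-1` orthant s) =
      \int[P]_w ((\1_(orthant s) (Z w) : R)%:E).
    rewrite (eq_integral (fun w => (\1_(Z @^-1` orthant s) w)%:E)) //.
    by rewrite integral_indic ?setIT //; exact: measurable_preimage_orthant.
  apply: bounded_cvg_integral.
  - by move=> k; exact: measurable_ramps.
  - apply: (@measurable_indic _ _ _ _ (Z @^-1` orthant s)).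
    exact: measurable_preimage_orthant.
  - by move=> k w; rewrite ramps_ge0 ramps_le1.
  - by apply/aeW => w; exact: cvg_ramps_orthant.
have integralE k : \int[P1]_w (ramps k s (Z1 w))%:E = \int[P2]_w (ramps k s (Z2 w))%:E.
  have cvgE d (T : measurableType d) (P : probability T R)
      (Y : nat -> T -> I -> R) (Z : T -> I -> R) :
      (forall n i, measurable_fun setT (Y n ^~ i)) ->
      (forall i, measurable_fun setT (Z ^~ i)) ->
      {ae P, forall w, forall i, Y n w i @[n --> \oo] --> Z w i} ->
      \int[P]_w (ramps k s (Y n w))%:E @[n --> \oo] -->
      \int[P]_w (ramps k s (Z w))%:E.
    move=> mY mZ YZ; apply: bounded_cvg_integral.
    - by move=> n; exact: measurable_ramps.
    - exact: measurable_ramps.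
    - by move=> n w; rewrite ramps_ge0 ramps_le1.
    - by apply: filterS YZ => w YZw; exact: cvg_ramps.
  have /(cvg_unique (@ereal_hausdorff R)) := cvgE _ _ P1 _ _ mY1 mZ1 YZ1.
  apply; have := cvgE _ _ P2 _ _ mY2 mZ2 YZ2.
  apply: cvg_trans; apply: near_eq_cvg; near=> n; apply/esym.
  apply: (@family_law_integral _ _ _ _ P1 _ _ P2 (Y1 n) (Y2 n) _ _
    (fun v => (ramps k s v)%:E)) => //.
  - by apply: family_law_unique => //; exact: Y12.
  - apply/measurable_EFinP.
    apply: (@measurable_ramps _ _ _ (g_sigma_algebraType cylinders) id).
    exact: measurable_coordinate.
  - by move=> v; rewrite lee_fin ramps_ge0.
have /(cvg_unique (@ereal_hausdorff R)) := orthantE _ _ P1 _ mZ1.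
apply; have := orthantE _ _ P2 _ mZ2.
by apply: cvg_trans; apply: near_eq_cvg; near=> k; exact/esym/integralE.
Unshelve. all: by end_near. Qed.

End family_law_cvg.

(** * Increments along a grid *)

Section grid_increments.
Local Open Scope ereal_scope.
Context d (T : measurableType d) (R : realType) (P : probability T R).
Variable X : bool -> R -> {RV P >-> R}.
Hypothesis levyX : forall b, levy_process (X b).
Hypothesis indepX : independent_processes (X true) (X false).
Variable delta : R.
Hypothesis delta_ge0 : (0 <= delta)%R.

Definition grid_increment (b : bool) (i : nat) (w : T) : R :=
  (X b (i.+1%:R * delta)%R w - X b (i%:R * delta)%R w)%R.

Lemma measurable_grid_increment b i :
  measurable_fun setT (grid_increment b i).
Proof. exact: measurable_funB. Qed.

Lemma process_sigma_algebra_measurable (Z : R -> {RV P >-> R}) t :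
  (0 <= t)%R ->
  forall B : set R, measurable B -> process_sigma_algebra Z (Z t @^-1` B).
Proof. by move=> t0 B mB; apply: sub_sigma_algebra; exists t, B. Qed.

Lemma process_sigma_algebra_increments (Z : R -> {RV P >-> R}) (u : nat -> R) n
    (B : nat -> set R) :
  (forall i, 0 <= u i)%R -> (forall i, measurable (B i)) ->
  process_sigma_algebra Z
    [set w | forall i, (i < n)%N -> B i (Z (u i.+1) w - Z (u i) w)%R].
Proof.
move=> u0 mB.
pose G := [set C | exists t, exists B : set (measurableTypeR R),
         [/\ (0 <= t)%R, measurable B & C = Z t @^-1` B]].
(* With the sigma-algebra of the process as the measurable structure of [T], membership of the event
   becomes an ordinary measurability proof. *)
pose W : measurableType _ := g_sigma_algebraType G.
have mZ i : measurable_fun setT (Z (u i) : W -> R).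
  by move=> _ C mC; rewrite setTI; exact: process_sigma_algebra_measurable.
suff : measurable ([set w | forall i, (i < n)%N ->
    B i (Z (u i.+1) w - Z (u i) w)%R] : set W) by [].
have -> : [set w | forall i, (i < n)%N -> B i (Z (u i.+1) w - Z (u i) w)%R] =
    \big[setI/setT]_(i < n) ((fun w : W => Z (u i.+1) w - Z (u i) w)%R @^-1` B i).
  rewrite -(bigcap_mkord n
    (fun i => (fun w : W => Z (u i.+1) w - Z (u i) w)%R @^-1` B i)).
  by apply/seteqP; split.
apply: bigsetI_measurable => i _; rewrite -[X in measurable X]setTI.
by apply: measurable_funB.
Qed.

Lemma grid_increments_independent n (B : bool -> nat -> set R) :
  (forall b i, measurable (B b i)) ->
  P [set w | forall b i, (i < n)%N -> B b i (grid_increment b i w)] =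
  (\prod_(i < n) P [set w | B true i (grid_increment true i w)]) *
  (\prod_(i < n) P [set w | B false i (grid_increment false i w)]).
Proof.
move=> mB; pose u i : R := (i%:R * delta)%R.
have u0 i : (0 <= u i)%R by rewrite mulr_ge0.
rewrite (_ : [set w | _] =
    [set w | forall i, (i < n)%N -> B true i (grid_increment true i w)] `&`
    [set w | forall i, (i < n)%N -> B false i (grid_increment false i w)]).
  rewrite indepX; last 2 first.
  - exact: (@process_sigma_algebra_increments (X true) u n (B true)).
  - exact: (@process_sigma_algebra_increments (X false) u n (B false)).
  congr (_ * _).
  - apply: (levy_independent (levyX true) (t := u)) => [//|i _|i].
      by rewrite ler_wpM2r // ler_nat.
    exact: mB.
  - apply: (levy_independent (levyX false) (t := u)) => [//|i _|i].
      by rewrite ler_wpM2r // ler_nat.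
    exact: mB.
apply/seteqP; split=> [w Bw|w [Bt Bf] [] i]; last 2 first.
- exact: Bt.
- exact: Bf.
- by split=> i; exact: Bw.
Qed.

Lemma grid_increment_stationary b i k (B : set R) : measurable B ->
  P [set w | B (grid_increment b (k + i) w)] =
  P [set w | B (grid_increment b i w)].
Proof.
move=> mB.
have E j : P [set w | B (grid_increment b j w)] =
    P [set w | B (X b delta w - X b 0 w)%R].
  rewrite -(@levy_stationary _ _ _ _ _ (levyX b) (j%:R * delta)%R delta) //.
    by rewrite /grid_increment mulrSr mulrDl mul1r.
  by rewrite mulr_ge0.
by rewrite !E.
Qed.

Section restart.
Variable K : nat.

Definition before_after (w w' : T) (j : bool * 'I_K + bool * nat) : R :=
  match j with
  | inl (b, i) => grid_increment b i w
  | inr (b, i) => grid_increment b i w'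
  end.

Definition straight (w : T) (j : bool * 'I_K + bool * nat) : R :=
  match j with
  | inl (b, i) => grid_increment b i w
  | inr (b, i) => grid_increment b (K + i) w
  end.

Lemma measurable_straight j : measurable_fun setT (straight ^~ j).
Proof. by case: j => -[b i]; exact: measurable_grid_increment. Qed.

Lemma measurable_before_after j :
  measurable_fun setT (fun w : T * T => before_after w.1 w.2 j).
Proof.
by case: j => -[b i]; apply: measurableT_comp => //;
  exact: measurable_grid_increment.
Qed.

(** All constraints of the list on one coordinate, gathered into a single Borel set, as the product
    formula for increments requires. *)
Let cond (s : seq ((bool * 'I_K + bool * nat) * R)) j : set R :=
  [set x | all (fun p => (p.1 == j) ==> (p.2 < x)%R) s].

Let measurable_cond s j : measurable (cond s j).
Proof.
elim: s => [|p s IHs].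
  by rewrite (_ : cond _ _ = setT) //; apply/seteqP; split.
rewrite (_ : cond _ _ = [set x | (p.1 == j) ==> (p.2 < x)%R] `&` cond s j).
  apply: measurableI => //; case: eqP => _ /=; last first.
    by rewrite (_ : mkset _ = setT) //; apply/seteqP; split.
  by rewrite -set_itvoy; exact: measurable_itv.
by apply/seteqP; split=> x; rewrite /cond /= => /andP.
Qed.

Let orthant_cond s : orthant s = [set v | forall j, cond s j (v j)].
Proof.
apply/seteqP; split=> v; rewrite /orthant /cond /=.
  move=> /allP sv j; apply/allP => p ps; apply/implyP => /eqP <-.
  exact: sv.
move=> sv; apply/allP => p ps.
by have /allP/(_ _ ps) := sv p.1; rewrite eqxx.
Qed.

(** The Markov property at a fixed index K. An orthant event is a product over the increments of
    both components; by stationarity the factors from K on are those of a walk started afresh, here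
    on an independent copy. *)
Lemma grid_restart_law S : <<s cylinders >> S ->
  P (straight @^-1` S) =
  (P \x P) ((fun w : T * T => before_after w.1 w.2) @^-1` S).
Proof.
apply: family_law_unique.
- exact: measurable_straight.
- exact: measurable_before_after.
move=> s; rewrite orthant_cond.
(* Only finitely many later increments are constrained: from M on the conditions are trivial. *)
pose M := (\max_(p <- s) (if p.1 is inr (b, i) then i.+1 else 0))%N.
have condT b i : (M <= i)%N -> cond s (inr (b, i)) = setT.
  move=> Mi; apply/seteqP; split=> // x _; apply/allP => p ps.
  apply/implyP => /eqP pi; have : (i < M)%N.
    rewrite /M (big_rem p) //= pi; exact: leq_maxl.
  by rewrite ltnNge Mi.
(* The conditions on the first K increments and on the later ones, glued into one family indexed
   along the walk. *)
pose B b i : set R := if insub i is Some i' then cond s (inl (b, i'))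
  else cond s (inr (b, (i - K)%N)).
have mB b i : measurable (B b i).
  by rewrite /B; case: insub => [i'|]; exact: measurable_cond.
have Bl b (i : 'I_K) : B b i = cond s (inl (b, i)) by rewrite /B valK.
have Br b i : B b (K + i)%N = cond s (inr (b, i)).
  by rewrite /B insubF ?addKn // ltnNge leq_addr.
have -> : straight @^-1` [set v | forall j, cond s j (v j)] =
    [set w | forall b i, (i < K + M)%N -> B b i (grid_increment b i w)].
  apply/seteqP; split=> w /= sw.
    move=> b i _; have [iK|Ki] := ltnP i K.
      by have := sw (inl (b, Ordinal iK)); rewrite -Bl.
    by have := sw (inr (b, i - K)%N); rewrite -Br /= subnKC.
  case=> -[b i].
    by rewrite -Bl; apply: sw; rewrite (leq_trans (ltn_ord i)) ?leq_addr.
  have [iM|Mi] := ltnP i M; last by rewrite condT.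
  by rewrite -Br; apply: sw; rewrite ltn_add2l.
have -> : (fun w : T * T => before_after w.1 w.2) @^-1`
      [set v | forall j, cond s j (v j)] =
    [set w | forall b i, (i < K)%N -> B b i (grid_increment b i w)] `*`
    [set w | forall b i, (i < M)%N -> B b (K + i)%N (grid_increment b i w)].
  apply/seteqP; split=> -[w w'] /=.
    move=> sw; split=> b i iK.
      by have := sw (inl (b, Ordinal iK)); rewrite -Bl.
    by rewrite Br; exact: sw (inr (b, i)).
  move=> [sw sw'] [] [b i]; first by rewrite -Bl; exact: sw.
  have [iM|Mi] := ltnP i M; last by rewrite condT.
  by rewrite -Br; exact: sw'.
have mbox n (C : bool -> nat -> set R) : (forall b i, measurable (C b i)) ->
    measurable [set w | forall b i, (i < n)%N -> C b i (grid_increment b i w)].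
  move=> mC; rewrite (_ : [set w | _] = \bigcap_(i in `I_n)
      (grid_increment true i @^-1` C true i `&`
       grid_increment false i @^-1` C false i)).
    apply: fin_bigcap_measurable => // i _; apply: measurableI;
      rewrite -[X in measurable X]setTI; exact: measurable_grid_increment.
  apply/seteqP; split=> [w Cw i /= iN|w Cw [] i iN]; last 2 first.
  - by have [] := Cw i iN.
  - by have [] := Cw i iN.
  - by split; exact: Cw.
apply: etrans; last first.
  apply/esym; exact: (product_measure1E P P (mbox K B mB)
    (mbox M (fun b i => B b (K + i)%N) (fun b i => mB b (K + i)%N))).
rewrite grid_increments_independent //.
have prodE b : \prod_(i < K + M) P [set w | B b i (grid_increment b i w)] =
    (\prod_(i < K) P [set w | B b i (grid_increment b i w)]) *
    \prod_(i < M) P [set w | B b (K + i)%N (grid_increment b i w)].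
  rewrite big_split_ord /=; congr (_ * _); apply: eq_bigr => i _.
  by rewrite grid_increment_stationary.
rewrite !prodE muleACA; congr (_ * _).
  by rewrite -grid_increments_independent.
by rewrite -(@grid_increments_independent M (fun b i => B b (K + i)%N)).
Qed.

End restart.
End grid_increments.

(** * First passage of right-continuous paths *)

Section right_continuous_paths.
Context {R : realType}.
Implicit Types (f : R -> R) (t x : R) (n : nat).

(** The filter at the right of t is punctured while the sequence may take the value t, which is
    treated separately. *)
Lemma cvg_right_sequence f t (u : nat -> R) :
  f s @[s --> t^'+] --> f t -> (forall n, t <= u n) ->
  u n @[n --> \oo] --> t -> f (u n) @[n --> \oo] --> f t.
Proof.
move=> ft tu ut; apply/cvgrPdist_lt => e e0.
have [r /= r0 rP] : exists2 r : R, 0 < r &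
    forall s, t < s -> s < t + r -> `|f t - f s| < e.
  move/cvgrPdist_lt : ft => /(_ e e0) [r /= r0 rP].
  exists r => // s ts sr; apply: rP => //=.
  by rewrite ltr0_norm ?subr_lt0 // opprB ltrBlDl.
near=> n.
have [<-|tun] := eqVneq t (u n); first by rewrite subrr normr0.
apply: rP; first by rewrite lt_neqAle tun tu.
rewrite -ltrBlDl; near: n.
move/cvgrPdist_lt : ut => /(_ r r0); apply: filterS => n.
by apply: le_lt_trans; rewrite distrC ler_norm.
Unshelve. all: by end_near. Qed.

Definition mesh n : R := n.+1%:R^-1.

Lemma mesh_gt0 n : 0 < mesh n. Proof. by rewrite invr_gt0. Qed.

Lemma cvg_mesh : mesh n @[n --> \oo] --> (0 : R).
Proof. exact: cvg_harmonic. Qed.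

(* Strictly to the right of [x], so that right continuity at [x] applies. *)
Definition next_index n x : nat := (Num.truncn (x / mesh n)).+1.

Lemma next_index_itv n x : 0 <= x ->
  x < (next_index n x)%:R * mesh n <= x + mesh n.
Proof.
move=> x0; have m0 := mesh_gt0 n; rewrite /next_index.
have /truncn_itv/andP[] : 0 <= x / mesh n by rewrite divr_ge0 // ltW.
rewrite ler_pdivlMr // ltr_pdivrMr // => h -> /=.
by rewrite mulrSr mulrDl mul1r lerD2r.
Qed.

Lemma squeeze_mesh (u : nat -> R) x :
  (forall n, x <= u n <= x + mesh n) -> u n @[n --> \oo] --> x.
Proof.
move=> xu; apply: (@squeeze_cvgr _ _ _ _ (fun=> x) (fun n => x + mesh n)).
- by apply: nearW.
- exact: cvg_cst.
- by rewrite -[X in _ --> X]addr0; apply: cvgD; [exact: cvg_cst|exact: cvg_mesh].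
Qed.

Lemma cvg_next_index f x : 0 <= x -> f s @[s --> x^'+] --> f x ->
  f ((next_index n x)%:R * mesh n) @[n --> \oo] --> f x.
Proof.
move=> x0 fx.
apply: (@cvg_right_sequence f x (fun n => (next_index n x)%:R * mesh n)) => //.
  by move=> n; have /andP[/ltW] := next_index_itv n x0.
by apply: squeeze_mesh => n; have /andP[/ltW -> ->] := next_index_itv n x0.
Qed.

(** The default 0, when u never exceeds t, has probability zero for the walks of a stable
    subordinator. *)
Definition first_above (u : nat -> R) t : nat :=
  if pselect (exists i, t < u i) is left h then ex_minn h else 0%N.

Lemma first_aboveP (u : nat -> R) t : (exists i, t < u i) ->
  t < u (first_above u t) /\ forall j, (j < first_above u t)%N -> u j <= t.
Proof.
move=> h; rewrite /first_above; case: pselect => // h'.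
case: ex_minnP => m mP mmin; split=> // j jm.
by rewrite leNgt; apply/negP => /mmin; rewrite leqNgt jm.
Qed.

Lemma first_above_eq (u : nat -> R) t K : t < u K ->
  (forall j, (j < K)%N -> u j <= t) -> first_above u t = K.
Proof.
move=> tK minK; have [tN minN] := first_aboveP (ex_intro (fun i => t < u i) K tK).
apply/eqP; rewrite eqn_leq; apply/andP; split; rewrite leqNgt; apply/negP.
  by move/minN; rewrite leNgt tK.
by move/minK; rewrite leNgt tN.
Qed.

End right_continuous_paths.

(** * The first passage of a single path *)

Section generalized_inverse.
Context {R : realType}.
Variable f : R -> R.

(** The pathwise form of [inverse_subordinator], convertible to it. *)
Definition ginv (t : R) : R := inf [set s | 0 <= s /\ t < f s].

Let has_lb t : has_lbound [set s | 0 <= s /\ t < f s].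
Proof. by exists 0 => s []. Qed.

Lemma ginv_ge0 t : 0 <= ginv t.
Proof.
rewrite /ginv; have [->|/set0P ne] := eqVneq [set s | 0 <= s /\ t < f s] set0.
  by rewrite inf0.
by apply: lb_le_inf => // s [].
Qed.

Lemma ginv_le t s : 0 <= s -> t < f s -> ginv t <= s.
Proof. by move=> s0 ts; apply: ge_inf. Qed.

Hypothesis f_right : forall t, 0 <= t -> f s @[s --> t^'+] --> f t.
Hypothesis f_nd : forall s t, 0 <= s -> s <= t -> f s <= f t.
Hypothesis f_unbounded : forall M, exists i : nat, M < f i%:R.

(** Unboundedness makes the set nonempty, which excludes the default value 0 of its infimum. *)
Lemma ginv_lt t s : ginv t < s -> t < f s.
Proof.
move=> /inf_lt h; have [|x [x0 tx] xs] := h.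
  by have [i ti] := f_unbounded t; exists i%:R; split.
by apply: lt_le_trans tx _; apply: f_nd => //; exact: ltW.
Qed.

(** A limit from the right of values above t. The inequality is not strict: a path may reach t
    continuously. *)
Lemma le_ginv t : t <= f (ginv t).
Proof.
have h := cvg_next_index (ginv_ge0 t) (f_right (ginv_ge0 t)).
rewrite -(cvg_lim _ h) //; apply: limr_ge; first exact: cvgP h.
apply: nearW => n; apply/ltW/ginv_lt.
by have /andP[] := next_index_itv n (ginv_ge0 t).
Qed.

Lemma lt_ginv t s : 0 <= s -> s < ginv t -> f s <= t.
Proof.
by move=> s0 st; rewrite leNgt; apply/negP => /(ginv_le s0); rewrite leNgt st.
Qed.

Lemma ginvE t s : 0 <= s -> t < f s ->
  (forall x, 0 <= x -> x < s -> f x <= t) -> ginv t = s.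
Proof.
move=> s0 ts xs; apply/eqP; rewrite eq_le ginv_le //= leNgt; apply/negP => lt.
have /ginv_lt : ginv t < (ginv t + s) / 2 by lra.
rewrite ltNge xs //; last lra.
by rewrite divr_ge0 // addr_ge0 // ginv_ge0.
Qed.

Lemma grid_passage_exists n t : exists i, t < f (i%:R * mesh n).
Proof.
have [i ti] := f_unbounded t; exists (i * n.+1)%N.
by rewrite natrM -mulrA mulfV ?mulr1 ?pnatr_eq0.
Qed.

(** The grid point preceding the first one above t is at most the passage time, so the grid is late
    by at most one mesh. *)
Lemma ginv_grid n t : f 0 <= t ->
  ginv t <= (first_above (fun i => f (i%:R * mesh n)) t)%:R * mesh n
         <= ginv t + mesh n.
Proof.
move=> f0t; have m0 := @mesh_gt0 R n.
have := first_aboveP (grid_passage_exists n t); set N := first_above _ _.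
move=> [tN minN]; apply/andP; split.
  by apply: ginv_le => //; rewrite mulr_ge0 // ltW.
case: N tN minN => [|N] tN minN.
  by move: tN; rewrite mul0r ltNge f0t.
rewrite mulrSr mulrDl mul1r lerD2r leNgt; apply/negP => /ginv_lt.
by rewrite ltNge minN.
Qed.

End generalized_inverse.

(** * Almost sure properties of the paths *)

Section stable_paths.
Context d (T : measurableType d) (R : realType) (P : probability T R).
Variables (alpha c : R) (A D : R -> {RV P >-> R}).
Hypotheses (c_gt0 : 0 < c) (levyA : levy_process A).
Hypothesis stableD : stable_subordinator alpha c D.

Let levyD : levy_process D := stable_levy stableD.

Lemma laplace_integral (t u : R) : 0 <= t -> 0 <= u ->
  (\int[P]_w (expR (- (u * D t w)))%:E = (expR (- (t * c * u `^ alpha)))%:E)%E.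
Proof. by move=> t0 u0; have := stable_laplace stableD t0 u0; rewrite unlock. Qed.

(** Chernoff's bound with the Laplace transform at u = 1, where u^alpha = 1. *)
Lemma subordinator_tail (M t : R) : 0 <= t ->
  (P [set w | D t w <= M]%R <= (expR (M - t * c))%:E)%E.
Proof.
move=> t0; have mS : measurable [set w | D t w <= M].
  rewrite (_ : [set w | _] = D t @^-1` `]-oo, M]%classic).
    by rewrite -[X in measurable X]setTI; exact: measurable_funP.
  by apply/seteqP; split=> w /=; rewrite in_itv.
have me : measurable_fun setT (fun w => (expR (- (1 * D t w)))%:E).
  apply/measurable_EFinP; apply: measurableT_comp => //.
  by apply: measurable_funN; apply: measurable_funM.
rewrite expRD EFinM.
have := laplace_integral t0 ler01; rewrite powR1 mulr1 => <-.
rewrite -ge0_integralZl_EFin ?expR_ge0 //.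
rewrite -[X in P X]setIT -integral_indic //.
apply: ge0_le_integral => //.
- by apply/measurable_EFinP; exact: measurable_indic.
- by apply: emeasurable_funM => //; exact: measurable_cst.
move=> w _; rewrite -EFinM lee_fin -expRD mul1r indicE.
case: (boolP (w \in _)) => [|_]; last exact: expR_ge0.
rewrite inE /= => DM; apply: le_trans (expR_ge1Dx _).
by rewrite lerDl subr_ge0.
Qed.

(** For an integer level k, the event that D_i <= k for all i has probability at most e^(k - i c)
    for each i, hence 0. Integer levels keep the union of exceptional sets countable. *)
Lemma subordinator_unbounded_ae :
  {ae P, forall w, forall M : R, exists i : nat, M < D i%:R w}.
Proof.
have : {ae P, forall w, forall k : nat, exists i : nat, k%:R < D i%:R w}.
  apply: ae_foralln => k.
  have mS i : measurable [set w | D i%:R w <= k%:R].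
    rewrite (_ : [set w | _] = D i%:R @^-1` `]-oo, k%:R]%classic).
      by rewrite -[X in measurable X]setTI; exact: measurable_funP.
    by apply/seteqP; split=> w /=; rewrite in_itv.
  exists (\bigcap_i [set w | D i%:R w <= k%:R]); split.
  - exact: bigcapT_measurable.
  - apply/eqP; rewrite eq_le measure_ge0 andbT.
    have cvg0 : (expR (k%:R - i%:R * c))%:E @[i --> \oo] --> (0 : \bar R)%E.
      apply: cvg_EFin; first by apply: nearW.
      rewrite (_ : _ \o _ = fun i => expR k%:R * expR (- c) ^+ i); last first.
        by apply/funext => i /=; rewrite expRD -expRM_natl mulrN.
      rewrite -[X in _ --> X](mulr0 (expR k%:R)); apply: cvgMr.
      by apply: cvg_expr; rewrite ger0_norm ?expR_ge0 // expR_lt1 oppr_lt0.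
    rewrite -(cvg_lim _ cvg0) //; apply: lime_ge; first exact: cvgP cvg0.
    apply: nearW => i; apply: le_trans (subordinator_tail _ _) => //.
    by apply: le_measure; rewrite ?inE //; [exact: bigcapT_measurable|exact: bigcap_inf].
  - move=> w /= /forallNP nw i _ /=; rewrite leNgt; apply/negP; exact: nw.
apply: filterS => w h M; have [i iw] := h (Num.truncn M).+1.
exists i; apply: lt_trans iw.
have [M0|M0] := leP 0 M; first by have /andP[] := truncn_itv M0.
by rewrite (lt_le_trans M0).
Qed.

(** What the pathwise arguments require beyond right continuity, which holds on all paths. *)
Definition regular_path (w : T) : Prop :=
  [/\ A 0 w = 0, D 0 w = 0,
      forall s t, 0 <= s -> s <= t -> D s w <= D t w &
      forall M : R, exists i : nat, M < D i%:R w].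

Lemma regular_path_ae : {ae P, forall w, regular_path w}.
Proof.
move: (levy_start levyA) (levy_start levyD) (stable_nondecreasing stableD)
  subordinator_unbounded_ae.
move=> hA hD hnd hu.
by apply: filterS2 (filterI hA hD) (filterI hnd hu) => w [? ?] [? ?]; split.
Qed.

End stable_paths.

(** * Measurability of passage times and of processes at random times *)

Section measurable_evaluation.
Context {R : realType} {d} {T : measurableType d}.
Implicit Types (f : R -> T -> R) (tau : T -> R) (u : nat -> T -> R).

Lemma measurable_fun_nat (N : T -> nat) :
  (forall k, measurable [set w | N w = k]) -> measurable_fun setT N.
Proof.
move=> mN _ B _; rewrite setTI.
rewrite (_ : _ @^-1` _ = \bigcup_(k in B) [set w | N w = k]).
  by apply: bigcup_measurable => k _; exact: mN.
by apply/seteqP; split=> w /= => [Bw|[k Bk ->] //]; exists (N w).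
Qed.

Lemma measurable_random_index u (N : T -> nat) :
  (forall k, measurable_fun setT (u k)) -> measurable_fun setT N ->
  measurable_fun setT (fun w => u (N w) w).
Proof.
move=> mu mN _ B mB; rewrite setTI.
rewrite (_ : _ @^-1` _ = \bigcup_k (N @^-1` [set k] `&` u k @^-1` B)).
  apply: bigcupT_measurable => k; apply: measurableI.
    by rewrite -[X in measurable X]setTI; exact: mN.
  by rewrite -[X in measurable X]setTI; exact: mu.
apply/seteqP; split=> w /= => [Bw|[k _ [/= -> //]]].
by exists (N w).
Qed.

Lemma measurable_set_lt (g h : T -> R) : measurable_fun setT g ->
  measurable_fun setT h -> measurable [set w | g w < h w].
Proof.
move=> mg mh; rewrite (_ : [set w | _] = setT `&` (fun w => g w < h w) @^-1` [set true]).
  by apply: measurable_fun_ltr.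
by apply/seteqP; split=> w //= [].
Qed.

Lemma measurable_set_le (g h : T -> R) : measurable_fun setT g ->
  measurable_fun setT h -> measurable [set w | g w <= h w].
Proof.
move=> mg mh; rewrite (_ : [set w | _] = ~` [set w | h w < g w]).
  by apply: measurableC; exact: measurable_set_lt.
by apply/seteqP; split=> w /=; rewrite leNgt => /negP.
Qed.

Definition first_at u (tau : R) (k : nat) : set T :=
  [set w | tau < u k w /\ forall j, (j < k)%N -> u j w <= tau].

Lemma measurable_first_at u a k : (forall k, measurable_fun setT (u k)) ->
  measurable (first_at u a k).
Proof.
move=> mu; rewrite /first_at (_ : mkset _ = [set w | a < u k w] `&`
    \bigcap_(j in `I_k) [set w | u j w <= a]).
  apply: measurableI; first exact: measurable_set_lt.
  by apply: fin_bigcap_measurable => // j _; exact: measurable_set_le.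
by apply/seteqP; split.
Qed.

Lemma measurable_first_above u a : (forall k, measurable_fun setT (u k)) ->
  measurable_fun setT (fun w => first_above (u ^~ w) a).
Proof.
move=> mu; apply: measurable_fun_nat => k.
pose never := \bigcap_j [set w | u j w <= a].
have mnever : measurable never.
  by apply: bigcapT_measurable => j; exact: measurable_set_le.
have neverP w : never w <-> ~ exists i, a < u i w.
  split=> [h [i]|h i _ /=]; first by rewrite ltNge h.
  by rewrite leNgt; apply/negP => ai; apply: h; exists i.
(* The default value adds the paths that never exceed a to the event of index 0. *)
rewrite (_ : [set w | _] = first_at u a k `|` [set w | never w /\ 0%N = k]).
  apply: measurableU; first exact: measurable_first_at.
  have [<-|/eqP k0] := eqVneq 0%N k.
    by rewrite (_ : mkset _ = never) //; apply/seteqP; split=> w // [].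
  by rewrite (_ : mkset _ = set0) //; apply/seteqP; split=> w // [_ /k0].
apply/seteqP; split=> w /=.
  move=> <-; have [h|h] := pselect (exists i, a < u i w).
    by left; exact: (@first_aboveP _ (u ^~ w)).
  right; split; first exact/neverP.
  by rewrite /first_above; case: pselect.
move=> [[ak mink]|[/neverP h <-]]; first exact: first_above_eq.
by rewrite /first_above; case: pselect.
Qed.

Lemma measurable_next_index n tau : measurable_fun setT tau ->
  (forall w, 0 <= tau w) -> measurable_fun setT (fun w => next_index n (tau w)).
Proof.
move=> mtau tau0; apply: measurable_fun_nat => -[|k].
  by rewrite (_ : mkset _ = set0) //; apply/seteqP; split.
have m0 := @mesh_gt0 R n.
rewrite (_ : [set w | _] = [set w | k%:R * mesh n <= tau w] `&`
    [set w | tau w < k.+1%:R * mesh n]).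
  by apply: measurableI; [exact: measurable_set_le|exact: measurable_set_lt].
apply/seteqP; split=> w /=; rewrite /next_index.
  move=> [<-]; have /truncn_itv/andP[] : 0 <= tau w / mesh n.
    by rewrite divr_ge0 // ltW.
  by rewrite ler_pdivlMr // ltr_pdivrMr.
move=> [h1 h2]; congr S; apply/eqP.
have tau0w : 0 <= tau w / mesh n by rewrite divr_ge0 // ltW.
by rewrite truncn_eq // ler_pdivlMr // ltr_pdivrMr // h1.
Qed.

(* The first passage computed on the grids only: unlike [ginv], it depends
   measurably on an arbitrary path. *)
Definition grid_inf (g : R -> R) (t : R) : R :=
  inf [set s | (exists n i, s = i%:R * mesh n) /\ t < g s].

Let grid_ge0 n i : 0 <= i%:R * mesh n :> R.
Proof. by rewrite mulr_ge0 // ltW // mesh_gt0. Qed.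

Let has_lb_grid (g : R -> R) t :
  has_lbound [set s | (exists n i, s = i%:R * mesh n) /\ t < g s].
Proof. by exists 0 => s [[n [i ->]] _]; exact: grid_ge0. Qed.

Lemma grid_inf_ge0 g t : 0 <= grid_inf g t.
Proof.
rewrite /grid_inf; set S := mkset _; have [->|/set0P ne] := eqVneq S set0.
  by rewrite inf0.
by apply: lb_le_inf => // s [[n [i ->]] _]; exact: grid_ge0.
Qed.

(** If g exceeds t at s, right continuity makes it exceed t at grid points arbitrarily close to s on
    the right. Hence the two infima agree, and their sets are empty together, where both take the
    default value. *)
Lemma ginv_grid_inf (g : R -> R) t :
  (forall t, 0 <= t -> g s @[s --> t^'+] --> g t) -> ginv g t = grid_inf g t.
Proof.
move=> g_right.
have le_grid s : 0 <= s -> t < g s -> grid_inf g t <= s /\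
    exists n, t < g ((next_index n s)%:R * mesh n).
  move=> s0 ts; have h := cvg_next_index s0 (g_right s s0).
  have ev : \forall n \near \oo, t < g ((next_index n s)%:R * mesh n).
    exact: (cvgr_gt _ h).
  split; last by have [n _ /(_ n (leqnn n))] := ev; exists n.
  have cv : (next_index n s)%:R * mesh n @[n --> \oo] --> s.
    apply: squeeze_mesh => n.
    by have /andP[/ltW -> ->] := next_index_itv n s0.
  rewrite -[leRHS](cvg_lim _ cv) //; apply: limr_ge; first exact: cvgP cv.
  apply: filterS ev => n tn; apply: ge_inf => //; split => //.
  by exists n, (next_index n s).
have [E0|/set0P[s [s0 ts]]] := eqVneq [set s | 0 <= s /\ t < g s] set0.
  rewrite /ginv E0 /grid_inf (_ : mkset _ = set0) //.
  apply/seteqP; split=> // s [[n [i ->]] ti].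
  by rewrite -E0; split.
apply/eqP; rewrite eq_le; apply/andP; split; last first.
  by apply: lb_le_inf; [exists s|move=> x [x0 tx]; have [] := le_grid x x0 tx].
apply: lb_le_inf => [|x [[n [i ->]] tx]]; last exact: ginv_le.
have [_ [n tn]] := le_grid s s0 ts.
by exists ((next_index n s)%:R * mesh n); split=> //; exists n, (next_index n s).
Qed.

Lemma measurable_grid_inf f tau : (forall s, 0 <= s -> measurable_fun setT (f s)) ->
  measurable_fun setT tau ->
  measurable_fun setT (fun w => grid_inf (f ^~ w) (tau w)).
Proof.
move=> mf mtau; apply: (measurability (@RGenInftyO.G R)).
  exact: RGenInftyO.measurableE.
move=> _ [_ [x ->] <-]; rewrite setTI.
pose g n i := [set w | tau w < f (i%:R * mesh n) w].
have mg n i : measurable (g n i) by apply: measurable_set_lt => //; exact: mf.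
(* Where no grid point qualifies, the infimum is 0, and it is below x exactly when x > 0. *)
pose never := \bigcap_n \bigcap_i (~` g n i).
have mnever : measurable never.
  by do 2 apply: bigcapT_measurable => ?; exact: measurableC.
rewrite (_ : _ @^-1` _ = (\bigcup_n \bigcup_(i in [set i | i%:R * mesh n < x]) g n i)
    `|` (never `&` [set w | 0 < x])).
  apply: measurableU.
    by apply: bigcupT_measurable => n; apply: bigcup_measurable => i _.
  have [x0|x0] := boolP (0 < x).
    by apply: measurableI => //; rewrite (_ : mkset _ = setT) //; apply/seteqP; split.
  by rewrite (_ : mkset _ = set0) ?setI0 //; apply/seteqP; split.
apply/seteqP; split=> w /=; rewrite in_itv /=.
  move=> lt; have [nev|nnev] := pselect (never w).
    by right; split => //; exact: le_lt_trans (grid_inf_ge0 _ _) lt.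
  left; have [|s [[n [i ->]] ts] sx] := inf_lt _ lt; last first.
    by exists n => //; exists i.
  move/existsNP : nnev => [n /not_implyP[_ /existsNP[i /not_implyP[_ /contrapT gni]]]].
  by exists (i%:R * mesh n); split => //; exists n, i.
move=> [[n _ [i /= ix gi]]|[nev x0]].
  apply: le_lt_trans ix; apply: ge_inf => //; split => //.
  by exists n, i.
rewrite /grid_inf (_ : mkset _ = set0) ?inf0 //.
by apply/seteqP; split => // s [[n [i ->]] ts]; exact: (nev n I i I).
Qed.

Lemma measurable_ginv f tau :
  (forall w t, 0 <= t -> f s w @[s --> t^'+] --> f t w) ->
  (forall s, 0 <= s -> measurable_fun setT (f s)) ->
  measurable_fun setT tau ->
  measurable_fun setT (fun w => ginv (f ^~ w) (tau w)).
Proof.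
move=> fr mf mtau; rewrite (_ : (fun w => _) = fun w => grid_inf (f ^~ w) (tau w)).
  exact: measurable_grid_inf.
by apply/funext => w; apply: ginv_grid_inf => t t0; exact: fr.
Qed.

(** The variable is the limit of its values at the next grid times after [tau], each of which takes
    countably many values. *)
Lemma measurable_eval f tau :
  (forall w t, 0 <= t -> f s w @[s --> t^'+] --> f t w) ->
  (forall s, 0 <= s -> measurable_fun setT (f s)) ->
  measurable_fun setT tau -> (forall w, 0 <= tau w) ->
  measurable_fun setT (fun w => f (tau w) w).
Proof.
move=> fr mf mtau tau0.
apply: (@measurable_fun_cvg _ _ _ _
  (fun n w => f ((next_index n (tau w))%:R * mesh n) w)).
- move=> n; apply: (@measurable_random_index (fun i => f (i%:R * mesh n))).
    by move=> i; exact: mf.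
  exact: measurable_next_index.
- by move=> w _; apply: (@cvg_next_index _ (f ^~ w)) => //; exact: fr.
Qed.

(* The limsup makes this defined, and measurable, on arbitrary paths. *)
Definition grid_time_change (a g : R -> R) (t : R) : R :=
  fine (limn_esup (fun n =>
    (a ((next_index n (grid_inf g t))%:R * mesh n))%:E)).

Lemma grid_time_changeE (a g : R -> R) t :
  (forall t, 0 <= t -> a s @[s --> t^'+] --> a t) ->
  (forall t, 0 <= t -> g s @[s --> t^'+] --> g t) ->
  grid_time_change a g t = a (ginv g t).
Proof.
move=> ar gr; rewrite /grid_time_change -ginv_grid_inf //.
have h := cvg_next_index (ginv_ge0 g t) (ar _ (ginv_ge0 g t)).
rewrite is_cvg_limn_esupE; first by rewrite EFin_lim //=; [rewrite (cvg_lim _ h)|exact: cvgP h].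
by apply/cvg_ex; exists (a (ginv g t))%:E; apply: cvg_EFin => //; exact: nearW.
Qed.

Lemma measurable_grid_time_change (f g : R -> T -> R) tau :
  (forall s, 0 <= s -> measurable_fun setT (f s)) ->
  (forall s, 0 <= s -> measurable_fun setT (g s)) ->
  measurable_fun setT tau ->
  measurable_fun setT (fun w => grid_time_change (f ^~ w) (g ^~ w) (tau w)).
Proof.
move=> mf mg mtau; apply: (measurableT_comp (@fine_measurable R setT measurableT)).
apply: measurable_fun_limn_esup => n; apply/measurable_EFinP.
apply: (@measurable_random_index (fun i => f (i%:R * mesh n))).
  by move=> i; exact: mf.
apply: measurable_next_index; last by move=> w; exact: grid_inf_ge0.
exact: measurable_grid_inf.
Qed.

End measurable_evaluation.

(** * The strong Markov property at the first passage *)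

Section partition.
Local Open Scope ereal_scope.
Context d (T : measurableType d) (R : realType) (P : probability T R).

Lemma probability_partition (E : (set T)^nat) (F : set T) :
  (forall k, measurable (E k)) -> trivIset setT E -> P (\bigcup_k E k) = 1 ->
  measurable F -> P F = \sum_(k <oo) P (F `&` E k).
Proof.
move=> mE tE E1 mF.
have mU : measurable (\bigcup_k E k) by exact: bigcupT_measurable.
have U0 : P (~` \bigcup_k E k) = 0 by rewrite probability_setC // E1 subee.
have -> : P F = P (F `&` \bigcup_k E k).
  rewrite (measureDI P mF mU) [X in X + _](_ : _ = 0) ?add0e //.
  apply/eqP; rewrite eq_le measure_ge0 andbT -U0.
  apply: le_measure; rewrite ?inE; [exact: measurableD|exact: measurableC|].
  by rewrite setDE; exact: subIsetr.
rewrite setI_bigcupr measure_bigcup; last 2 first.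
- by move=> k _; exact: measurableI.
- exact: trivIset_setIl.
by apply: eq_eseriesl => k; rewrite in_setT.
Qed.

Lemma ae_probability1 (S : set T) : measurable S -> {ae P, forall w, S w} ->
  P S = 1.
Proof.
move=> mS aeS; have : P (~` S) = 0.
  by apply: measure_negligible; [exact: measurableC|exact: aeS].
rewrite probability_setC // => /eqP.
by rewrite sube_eq ?fin_num_measure // add0e => /eqP.
Qed.

Lemma ae_eq_probability (S S' : set T) : measurable S -> measurable S' ->
  {ae P, forall w, S w <-> S' w} -> P S = P S'.
Proof.
move=> mS mS' SS'.
have indicE' (U : set T) : measurable U -> P U = \int[P]_w (\1_U w)%:E.
  by move=> mU; rewrite integral_indic // setIT.
rewrite !indicE' //; apply: ge0_ae_eq_integral => //.
- by apply/measurable_EFinP; exact: measurable_indic.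
- by apply/measurable_EFinP; exact: measurable_indic.
- apply: filterS SS' => w SS'w _; rewrite !indicE.
  have -> // : (w \in S) = (w \in S').
  by apply/idP/idP; rewrite !inE => /SS'w.
Qed.

Context d' (T' : measurableType d') (P' : probability T' R).

Lemma ae_prod1 (Q : T -> Prop) : {ae P, forall w, Q w} ->
  {ae (P \x P')%E, forall w, Q w.1}.
Proof.
move=> [N [mN N0 QN]]; exists (N `*` setT); split.
- exact: measurableX.
- transitivity (P N * P' setT); first exact: product_measure1E.
  by rewrite N0 mul0e.
- by move=> [w w'] /= nQ; split=> //; exact: QN.
Qed.

Lemma ae_prod2 (Q : T' -> Prop) : {ae P', forall w, Q w} ->
  {ae (P \x P')%E, forall w, Q w.2}.
Proof.
move=> [N [mN N0 QN]]; exists (setT `*` N); split.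
- exact: measurableX.
- transitivity (P setT * P' N); first exact: product_measure1E.
  by rewrite N0 mule0.
- by move=> [w w'] /= nQ; split=> //; exact: QN.
Qed.

End partition.

Section strong_markov.
Context d (T : measurableType d) (R : realType) (P : probability T R).
Variables (alpha c : R) (A D : R -> {RV P >-> R}).
Hypotheses (c_gt0 : 0 < c) (levyA : levy_process A).
Hypothesis stableD : stable_subordinator alpha c D.
Hypothesis indepAD : independent_processes A D.
Variable t0 : R.

Definition pair_process (b : bool) : R -> {RV P >-> R} := if b then A else D.
Local Notation X := pair_process.

Lemma pair_process_levy b : levy_process (X b).
Proof. by case: b; [exact: levyA|exact: stable_levy stableD]. Qed.

Lemma pair_process_right b w t : 0 <= t -> X b s w @[s --> t^'+] --> X b t w.
Proof. by move=> t0'; apply: (levy_cadlag (pair_process_levy b) w).1. Qed.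

Section grid.
Variable n : nat.

(** Started exactly at 0, hence a function of the grid increments on all paths; [X b 0] is only
    almost surely 0. *)
Definition walk (b : bool) (i : nat) (w : T) : R := X b (i%:R * mesh n) w - X b 0 w.

Lemma measurable_walk b i : measurable_fun setT (walk b i).
Proof. exact: measurable_funB. Qed.

Definition passage (w : T) : nat := first_above (walk false ^~ w) t0.

Lemma measurable_passage : measurable_fun setT passage.
Proof. by apply: measurable_first_above => k; exact: measurable_walk. Qed.

Definition grid_overshoot (w : T) : R := walk false (passage w) w - t0.

Lemma measurable_grid_overshoot : measurable_fun setT grid_overshoot.
Proof.
apply: measurable_funB => //; apply: measurable_random_index.
  by move=> k; exact: measurable_walk.
exact: measurable_passage.
Qed.

(** Including the overshoot as the coordinate [None] makes the joint law with the restarted pair the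
    law of one family. The absolute value lets all of [R] index times >= 0. *)
Definition grid_restart (w : T) (o : option (bool * R)) : R :=
  match o with
  | None => grid_overshoot w
  | Some (b, s) => X b ((passage w + next_index n `|s|)%:R * mesh n) w -
                   X b ((passage w)%:R * mesh n) w
  end.

Lemma measurable_grid_restart o : measurable_fun setT (grid_restart ^~ o).
Proof.
case: o => [[b s]|]; last exact: measurable_grid_overshoot.
apply: measurable_funB.
  apply: (@measurable_random_index _ _ _
    (fun k => X b ((k + next_index n `|s|)%:R * mesh n))) => //.
  exact: measurable_passage.
apply: (@measurable_random_index _ _ _ (fun k => X b (k%:R * mesh n))) => //.
exact: measurable_passage.
Qed.

Definition grid_fresh (w w' : T) (o : option (bool * R)) : R :=
  match o with
  | None => grid_overshoot w
  | Some (b, s) => walk b (next_index n `|s|) w'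
  end.

Lemma measurable_grid_fresh o :
  measurable_fun setT (fun w : T * T => grid_fresh w.1 w.2 o).
Proof.
case: o => [[b s]|]; apply: measurableT_comp => //.
  exact: measurable_walk.
exact: measurable_grid_overshoot.
Qed.

Lemma sum_grid_increments b k i w :
  \sum_(l < i) grid_increment X (mesh n) b (k + l) w =
  X b ((k + i)%:R * mesh n) w - X b (k%:R * mesh n) w.
Proof.
elim: i => [|i IHi]; first by rewrite big_ord0 addn0 subrr.
by rewrite big_ord_recr /= IHi /grid_increment addnS; ring.
Qed.

(** The walk of D rebuilt from the first K increments; it is the walk for i <= K, the only indices
    at which it is compared with it. *)
Definition before (K : nat) (v : bool * 'I_K + bool * nat -> R) (i : nat) : R :=
  \sum_(l < K | (l < i)%N) v (inl (false, l)).

Definition after (K : nat) (v : bool * 'I_K + bool * nat -> R) b (i : nat) : R :=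
  \sum_(l < i) v (inr (b, nat_of_ord l)).

Lemma beforeE K (v : bool * 'I_K + bool * nat -> R) i w : (i <= K)%N ->
  (forall l, v (inl (false, l)) = grid_increment X (mesh n) false l w) ->
  before v i = walk false i w.
Proof.
move=> iK vE; rewrite /before /walk.
have := sum_grid_increments false 0 i w; rewrite add0n mul0r => <-.
rewrite (big_ord_widen K (fun l => grid_increment X (mesh n) false l w)) //.
by apply: eq_bigr => l _; exact: vE.
Qed.

Definition passage_event (K : nat) : set T := first_at (walk false) t0 K.

Lemma measurable_passage_event K : measurable (passage_event K).
Proof. by apply: measurable_first_at => k; exact: measurable_walk. Qed.

Lemma passage_eventE K w : passage_event K w -> passage w = K.
Proof. by move=> [h1 h2]; exact: first_above_eq. Qed.

Lemma trivIset_passage_event : trivIset setT passage_event.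
Proof.
move=> i j _ _ [w [/passage_eventE <- /passage_eventE <-]] //.
Qed.

Lemma passage_event_cover : P (\bigcup_K passage_event K) = 1%E.
Proof.
apply: ae_probability1.
  by apply: bigcupT_measurable => k; exact: measurable_passage_event.
apply: filterS (regular_path_ae c_gt0 levyA stableD) => w [_ D0 _ Du].
have : exists i, t0 < walk false i w.
  have [i ti] := @grid_passage_exists _ (D ^~ w) Du n t0.
  by exists i; rewrite /walk /= D0 subr0.
by move=> /first_aboveP[h1 h2]; exists (passage w).
Qed.

Definition restart_path K (v : bool * 'I_K + bool * nat -> R)
    (o : option (bool * R)) : R :=
  match o with
  | None => before v K - t0
  | Some (b, s) => after v b (next_index n `|s|)
  end.

(** On passage at index K, that event and the overshoot depend on the first K increments, and the
    restarted walk on the later ones. The Markov property at the fixed index K applies, and the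
    events of passage at K partition the space up to a null set. *)
Lemma grid_restart_law_cylinders S : <<s cylinders >> S ->
  P (grid_restart @^-1` S) =
  (P \x P)%E ((fun w : T * T => grid_fresh w.1 w.2) @^-1` S).
Proof.
move=> mS.
have mE := measurable_passage_event.
rewrite (probability_partition mE trivIset_passage_event passage_event_cover);
  last exact: (measurable_preimage_cylinders measurable_grid_restart mS).
rewrite (@probability_partition _ _ _ (P \x P)%E
    (fun K => passage_event K `*` setT)); last 4 first.
- by move=> K; exact: measurableX.
- move=> i j _ _ [[w w'] [[/= wi _] [/= wj _]]].
  by apply: trivIset_passage_event => //; exists w.
- rewrite (_ : \bigcup_k _ = (\bigcup_k passage_event k) `*` setT); last first.
    apply/seteqP; split=> -[w w'] /= => [[k _ [wk _]]|[[k _ wk] _]].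
      by split=> //; exists k.
    by exists k.
  transitivity (P (\bigcup_k passage_event k) * P setT)%E.
    by apply: product_measure1E => //; exact: bigcupT_measurable.
  by rewrite passage_event_cover probability_setT mule1.
- exact: (measurable_preimage_cylinders measurable_grid_fresh mS).
apply: eq_eseriesr => K _.
pose J := (bool * 'I_K + bool * nat)%type.
pose W : measurableType _ := g_sigma_algebraType (@cylinders R J).
pose walkW j (v : W) := before (v : J -> R) j.
(* Passage at K together with the restarted walk in S, as an event on the increments alone. *)
pose SK : set (J -> R) := [set v | S (restart_path v)] `&` first_at walkW t0 K.
have mcoord (j : J) : measurable_fun setT
    (fun v : W => (v : J -> R) j).
  exact: measurable_coordinate.
have mbefore i : measurable_fun setT (walkW i).
  rewrite (_ : walkW i = fun v => \sum_(l < K)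
      if (l < i)%N then (v : J -> R) (inl (false, l)) else 0); last first.
    by apply/funext => v; rewrite /walkW /before big_mkcond.
  by apply: measurable_sum => l; case: (l < i)%N; [exact: mcoord|exact: measurable_cst].
have mSK : <<s cylinders >> SK.
  suff : measurable (SK : set W) by [].
  apply: measurableI; last exact: measurable_first_at.
  apply: (@measurable_preimage_cylinders _ _ _ W (@restart_path K)) => // -[[b s]|].
    by apply: measurable_sum => l; exact: mcoord.
  by apply: measurable_funB; [exact: (mbefore K)|exact: measurable_cst].
have := grid_restart_law (@pair_process_levy) indepAD (ltW (mesh_gt0 n)) mSK.
have beforeS w i : (i <= K)%N ->
    before (straight X (mesh n) w : J -> R) i = walk false i w.
  by move=> iK; exact: beforeE.
have beforeB w w' i : (i <= K)%N ->
    before (before_after X (mesh n) w w' : J -> R) i = walk false i w.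
  by move=> iK; exact: beforeE.
have first_atE (v : J -> R) w : (forall i, (i <= K)%N -> before v i = walk false i w) ->
    first_at walkW t0 K v <-> passage_event K w.
  move=> vE; rewrite /passage_event /first_at /walkW /= vE //.
  by split=> -[h1 h2]; split=> // j jK; have := h2 j jK; rewrite vE // ltnW.
have restartE w : passage_event K w ->
    grid_restart w = restart_path (straight X (mesh n) w : J -> R).
  move=> Ew; apply/funext => -[[b s]|] /=.
    by rewrite (passage_eventE Ew) /after sum_grid_increments.
  by rewrite beforeS // /grid_overshoot (passage_eventE Ew).
have -> : @straight _ _ _ _ X (mesh n) K @^-1` SK = grid_restart @^-1` S `&` passage_event K.
  apply/seteqP; split=> w /= [].
    move=> Sw /(first_atE _ w (beforeS w)) Ew; split => //.
    by rewrite restartE.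
  move=> Sw Ew; split; last exact/(first_atE _ w (beforeS w)).
  by move: Sw; rewrite restartE.
move=> ->; congr (_ _).
have freshE w w' : passage_event K w ->
    grid_fresh w w' = restart_path (before_after X (mesh n) w w' : J -> R).
  move=> Ew; apply/funext => -[[b s]|] /=.
    rewrite /after /=; have := sum_grid_increments b 0 (next_index n `|s|) w'.
    by rewrite add0n mul0r /walk => <-; apply: eq_bigr.
  by rewrite beforeB // /grid_overshoot (passage_eventE Ew).
apply/seteqP; split=> -[w w'] /= [].
  move=> Sw /(first_atE _ w (beforeB w w')) Ew; split => //=.
  by rewrite freshE.
move=> Sw [Ew _]; split; last exact/(first_atE _ w (beforeB w w')).
by move: Sw; rewrite freshE.
Qed.

End grid.
End strong_markov.

(** * The strong Markov property in continuous time *)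

Section strong_markov_limit.
Context d (T : measurableType d) (R : realType) (P : probability T R).
Variables (alpha c : R) (A D : R -> {RV P >-> R}).
Hypotheses (c_gt0 : 0 < c) (levyA : levy_process A).
Hypothesis stableD : stable_subordinator alpha c D.
Hypothesis indepAD : independent_processes A D.
Variable t0 : R.
Hypothesis t0_ge0 : 0 <= t0.
Local Notation X := (pair_process A D).

Definition passage_time (w : T) : R := inverse_subordinator D t0 w.

Lemma passage_time_ge0 w : 0 <= passage_time w.
Proof. exact: ginv_ge0. Qed.

Lemma measurable_passage_time : measurable_fun setT passage_time.
Proof.
apply: (@measurable_ginv _ _ _ D (fun=> t0)) => // w t t_ge0.
exact: (@pair_process_right _ _ _ _ alpha c A D levyA stableD false).
Qed.

Definition overshoot (w : T) : R := D (passage_time w) w - t0.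

Lemma measurable_overshoot : measurable_fun setT overshoot.
Proof.
apply: measurable_funB => //; apply: (@measurable_eval _ _ _ D passage_time) => //.
- by move=> w t t_ge0; exact: (@pair_process_right _ _ _ _ alpha c A D levyA stableD false).
- exact: measurable_passage_time.
- exact: passage_time_ge0.
Qed.

Definition restart (w : T) (o : option (bool * R)) : R :=
  match o with
  | None => overshoot w
  | Some (b, s) => X b (passage_time w + `|s|) w - X b (passage_time w) w
  end.

Definition fresh (w w' : T) (o : option (bool * R)) : R :=
  match o with
  | None => overshoot w
  | Some (b, s) => X b `|s| w'
  end.

Lemma measurable_restart o : measurable_fun setT (restart ^~ o).
Proof.
case: o => [[b s]|]; last exact: measurable_overshoot.
have meval r : 0 <= r -> measurable_fun setT (fun w => X b (passage_time w + r) w).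
  move=> r0; apply: (@measurable_eval _ _ _ (X b) (fun w => passage_time w + r)) => //.
  - by move=> w t t_ge0; exact: (@pair_process_right _ _ _ _ alpha c A D levyA stableD b).
  - by apply: measurable_funD => //; exact: measurable_passage_time.
  - by move=> w; rewrite addr_ge0 // passage_time_ge0.
apply: measurable_funB; first exact: meval.
by have := meval 0 (lexx 0); under eq_fun do rewrite addr0.
Qed.

Lemma measurable_fresh o : measurable_fun setT (fun w : T * T => fresh w.1 w.2 o).
Proof.
by case: o => [[b s]|]; apply: measurableT_comp => //; exact: measurable_overshoot.
Qed.

(** The grid passage times and the [v n] approach their limits from the right, so right continuity
    is enough although D may jump at the passage. *)
Lemma cvg_passage_grid w : regular_path A D w -> forall b s, 0 <= s ->
  forall (v : nat -> R), (forall n, s <= v n <= s + mesh n) ->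
  X b ((passage A D t0 n w)%:R * mesh n + v n) w @[n --> \oo] -->
  X b (passage_time w + s) w.
Proof.
move=> [A0 D0 Dnd Du] b s s0 v sv.
have Dr t : 0 <= t -> D x w @[x --> t^'+] --> D t w.
  exact: (@pair_process_right _ _ _ _ alpha c A D levyA stableD false).
have passageE n : passage A D t0 n w = first_above (fun i => D (i%:R * mesh n) w) t0.
  rewrite /passage; congr first_above; apply/funext => i.
  by rewrite /walk /= D0 subr0.
have grid n : passage_time w <= (passage A D t0 n w)%:R * mesh n <=
    passage_time w + mesh n.
  by rewrite passageE; apply: (@ginv_grid _ (D ^~ w)) => //; rewrite D0.
apply: (@cvg_right_sequence _ (fun x => X b x w) _
    (fun n => (passage A D t0 n w)%:R * mesh n + v n)).
- apply: (@pair_process_right _ _ _ _ alpha c A D levyA stableD b w).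
  by rewrite addr_ge0 // passage_time_ge0.
- by move=> n; apply: lerD; [have /andP[] := grid n|have /andP[] := sv n].
- apply: cvgD; exact: squeeze_mesh.
Qed.

Lemma cvg_grid_overshoot w : regular_path A D w ->
  grid_overshoot A D t0 n w @[n --> \oo] --> overshoot w.
Proof.
move=> rw; have [_ D0 _ _] := rw; rewrite /grid_overshoot /overshoot.
apply: cvgB; last exact: cvg_cst.
have h := @cvg_passage_grid w rw false 0 (lexx 0) (fun=> 0).
rewrite -[passage_time w]addr0.
apply: cvg_trans (h _); last by move=> n; rewrite lexx add0r ltW // mesh_gt0.
apply: near_eq_cvg; apply: nearW => n.
by rewrite /walk /= D0 subr0 addr0.
Qed.

(** Every coordinate converges on regular paths: those of the restarted path along the grid
    passages, those of the copy by right continuity and its start at 0. *)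
Lemma restart_law S : <<s cylinders >> S ->
  P (restart @^-1` S) = (P \x P)%E ((fun w : T * T => fresh w.1 w.2) @^-1` S).
Proof.
have rae := regular_path_ae c_gt0 levyA stableD.
have next_itv n (s : R) : `|s| <= (next_index n `|s|)%:R * mesh n <= `|s| + mesh n.
  by have /andP[/ltW -> ->] := next_index_itv n (normr_ge0 s).
apply: (@family_law_cvg _ _ _ _ P _ _ (P \x P)%E (fun n => grid_restart A D t0 n)
    (fun n => fun w : T * T => grid_fresh A D t0 n w.1 w.2)).
- by move=> n o; exact: measurable_grid_restart.
- by move=> n o; exact: measurable_grid_fresh.
- exact: measurable_restart.
- exact: measurable_fresh.
- apply: filterS rae => w rw [[b s]|]; last exact: cvg_grid_overshoot.
  apply: cvgB.
    have h := @cvg_passage_grid w rw b `|s| (normr_ge0 s)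
      (fun n => (next_index n `|s|)%:R * mesh n).
    apply: cvg_trans (h _); last by move=> n; exact: next_itv.
    by apply: near_eq_cvg; apply: nearW => n; rewrite natrD mulrDl.
  have h := @cvg_passage_grid w rw b 0 (lexx 0) (fun=> 0).
  rewrite -[passage_time w]addr0.
  apply: cvg_trans (h _); last by move=> n; rewrite lexx add0r ltW // mesh_gt0.
  by apply: near_eq_cvg; apply: nearW => n; rewrite addr0.
- apply: filterS2 (ae_prod1 P rae) (ae_prod2 P rae) => -[w w'] /= rw rw' [[b s]|];
    last exact: cvg_grid_overshoot.
  rewrite /= -[X in _ --> X]subr0; apply: cvgB.
    apply: (@cvg_next_index _ (fun x => X b x w')) => //.
    exact: (@pair_process_right _ _ _ _ alpha c A D levyA stableD b w').
  rewrite (_ : X b 0 w' = 0); first exact: cvg_cst.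
  by case: rw' => A0 D0 _ _; case: b.
- move=> n s.
  apply: (@grid_restart_law_cylinders _ _ _ P alpha c A D c_gt0 levyA stableD
    indepAD t0 n).
  by apply: sub_sigma_algebra; exists s.
Qed.

End strong_markov_limit.

(** * Uniqueness from moments *)

Section moments.
Context {R : realType}.

Lemma bernoulli_inequality (x : R) n : -1 <= x -> 1 + n%:R * x <= (1 + x) ^+ n.
Proof.
move=> x1; elim: n => [|n IHn]; first by rewrite mul0r addr0 expr0.
rewrite exprS; apply: le_trans (ler_wpM2l _ IHn); last lra.
have : 0 <= n%:R * (x * x) by rewrite mulr_ge0 // -expr2 sqr_ge0.
rewrite mulrSr; lra.
Qed.

(* Polynomials tending to the indicator of [0, a[ on [0, 1]: the exponent is
   such that M * a ^ m tends to infinity, but M * b ^ m to 0 for b < a. *)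
Definition step_exponent (a : R) (m : nat) : nat :=
  Num.truncn (m.+1%:R / a ^+ m.+1).

Definition step_poly (a : R) (m : nat) : {poly R} :=
  (1 - 'X^(m.+1)) ^+ step_exponent a m.

Lemma step_polyE a m y :
  (step_poly a m).[y] = (1 - y ^+ m.+1) ^+ step_exponent a m.
Proof. by rewrite horner_exp !hornerE. Qed.

Lemma step_poly01 a m y : 0 <= y <= 1 -> 0 <= (step_poly a m).[y] <= 1.
Proof.
move=> /andP[y0 y1]; rewrite step_polyE.
have x0 : 0 <= y ^+ m.+1 by exact: exprn_ge0.
have x1 : y ^+ m.+1 <= 1 by exact: exprn_ile1.
by rewrite exprn_ge0 ?exprn_ile1 //; lra.
Qed.

(** Write z = g^(-2) with g > 1. Bernoulli's inequality gives g^k >= k (g - 1), so z^k is at most 1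
    / (k (g - 1))^2. *)
Lemma geometric_linear_bound (z : R) : 0 < z < 1 ->
  exists C : R, forall k, (0 < k)%N -> k%:R * z ^+ k <= C * k%:R^-1.
Proof.
move=> /andP[z0 z1]; pose g := Num.sqrt z^-1.
have g1 : 1 < g.
  have zV0 : 0 < z^-1 by rewrite invr_gt0.
  by rewrite /g -[ltLHS]sqrtr1 ltr_sqrt // invf_gt1.
have gE k : z ^+ k = ((g ^+ k) ^+ 2)^-1.
  by rewrite -exprM mulnC exprM sqr_sqrtr ?invr_ge0 ?ltW // exprVn invrK.
exists ((g - 1) ^+ 2)^-1 => k k0.
have kR0 : 0 < k%:R :> R by rewrite ltr0n.
have gk : (k%:R * (g - 1)) ^+ 2 <= (g ^+ k) ^+ 2.
  have : 1 + k%:R * (g - 1) <= (1 + (g - 1)) ^+ k.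
    by apply: bernoulli_inequality; lra.
  rewrite (addrC 1 (g - 1)) subrK => h; rewrite lerXn2r ?nnegrE //.
  - by rewrite mulr_ge0 ?ltW // subr_gt0.
  - by rewrite exprn_ge0 // (le_trans _ (ltW g1)).
  - by apply: le_trans h; rewrite lerDr.
have d0 : 0 < (k%:R * (g - 1)) ^+ 2.
  by rewrite exprn_gt0 // mulr_gt0 // subr_gt0.
rewrite gE; apply: (@le_trans _ _ (k%:R * ((k%:R * (g - 1)) ^+ 2)^-1)).
  by rewrite (ler_wpM2l (ltW kR0)) // lef_pV2 // posrE (lt_le_trans d0).
rewrite le_eqVlt; apply/orP; left; apply/eqP; field.
by rewrite gt_eqF // gt_eqF // subr_gt0.
Qed.

Lemma cvg_step_poly a y : 0 < a -> 0 <= y <= 1 ->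
  (step_poly a m).[y] @[m --> \oo] --> ((y < a)%R%:R : R).
Proof.
move=> a0 /andP[y0 y1].
have x01 m : 0 <= y ^+ m.+1 <= 1 by rewrite exprn_ge0 // exprn_ile1.
have MP m : (step_exponent a m)%:R <= m.+1%:R / a ^+ m.+1 <
    (step_exponent a m).+1%:R.
  by apply: truncn_itv; rewrite divr_ge0 // exprn_ge0 // ltW.
have p01 m : 0 <= (step_poly a m).[y] <= 1 by rewrite step_poly01 // y0.
have [ya|ay] := ltP y a.
  have [C CP] : exists C : R, forall k, (0 < k)%N ->
      k%:R * (y / a) ^+ k <= C * k%:R^-1.
    have [->|yN0] := eqVneq y 0.
      by exists 0 => -[//|k] _; rewrite !mul0r expr0n mulr0.
    apply: geometric_linear_bound.
    have y_gt0 : 0 < y by rewrite lt_neqAle eq_sym yN0.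
    by rewrite divr_gt0 //= ltr_pdivrMr // mul1r.
  (* Let k = m + 1, x = y^k, and let M be the exponent. Below a, Bernoulli's inequality gives (1 -
     x)^M >= 1 - M x, and M x <= k (y / a)^k. *)
  apply: (@squeeze_cvgr _ _ _ _ (fun m => 1 - C * mesh m) (fun=> 1)).
  - apply: nearW => m; have /andP[_ ->] := p01 m; rewrite andbT step_polyE.
    have /andP[x0 x1] := x01 m.
    have := @bernoulli_inequality (- y ^+ m.+1) (step_exponent a m).
    rewrite lerN2 => /(_ x1); apply: le_trans.
    rewrite mulrN lerD2l lerN2.
    have /andP[M1 _] := MP m.
    apply: le_trans (ler_wpM2r x0 M1) _; apply: le_trans (CP m.+1 isT).
    by rewrite expr_div_n mulrAC mulrA.
  - rewrite -[X in _ --> X]subr0; apply: cvgB; first exact: cvg_cst.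
    by rewrite -[X in _ --> X](mulr0 C); apply: cvgMr; exact: cvg_mesh.
  - exact: cvg_cst.
(* From a on, (1 - x)^M (1 + M x) <= (1 - x^2)^M <= 1, while 1 + M x >= k because x >= a^k; so the
   value is at most 1 / k. *)
apply: (@squeeze_cvgr _ _ _ _ (fun=> 0) (fun m => mesh m)).
- apply: nearW => m; have /andP[-> _] := p01 m; rewrite andTb step_polyE.
  have /andP[x0 x1] := x01 m; have /andP[_ M2] := MP m.
  set M := step_exponent a m; set x := y ^+ m.+1.
  have k0 : 0 < m.+1%:R :> R by [].
  have le1 : (1 - x) ^+ M * (1 + M%:R * x) <= 1.
    apply: (@le_trans _ _ ((1 - x) ^+ M * (1 + x) ^+ M)).
      rewrite ler_wpM2l ?exprn_ge0 ?subr_ge0 // bernoulli_inequality //.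
      by rewrite (le_trans _ x0) // oppr_le0.
    rewrite -exprMn; apply: exprn_ile1.
      by rewrite mulr_ge0 ?subr_ge0 // addr_ge0.
    rewrite (_ : (1 - x) * (1 + x) = 1 - x ^+ 2); last by ring.
    by rewrite gerBl sqr_ge0.
  have big : m.+1%:R <= 1 + M%:R * x.
    apply: (@le_trans _ _ (m.+1%:R / a ^+ m.+1 * x)).
      rewrite -mulrA ler_peMr // mulrC ler_pdivlMr ?exprn_gt0 // mul1r.
      by rewrite /x lerXn2r ?nnegrE // ltW.
    apply: le_trans (ler_wpM2r x0 (ltW M2)) _.
    by rewrite mulrSr mulrDl mul1r addrC lerD2r.
  rewrite /mesh -[leRHS]mul1r ler_pdivlMr //.
  apply: le_trans le1; rewrite ler_wpM2l // exprn_ge0 // subr_ge0 //.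
- exact: cvg_cst.
- exact: cvg_mesh.
Qed.

Local Open Scope ereal_scope.

Lemma integral_horner d (T : measurableType d) (m : {measure set T -> \bar R})
    (D : set T) (w y : T -> R) (p : {poly R}) :
  measurable D -> (forall i, m.-integrable D (fun x => (w x * y x ^+ i)%:E)) ->
  \int[m]_(x in D) (w x * p.[y x])%:E =
  \sum_(i < size p) (p`_i)%:E * \int[m]_(x in D) (w x * y x ^+ i)%:E.
Proof.
move=> mD intw.
under eq_integral do rewrite horner_coef mulr_sumr.
rewrite (eq_integral (fun x => \sum_(i < size p) (p`_i)%:E * (w x * y x ^+ i)%:E)).
  rewrite integral_sum //; last by move=> i; exact: integrableZl.
  by apply: eq_bigr => i _; rewrite integralZl.
move=> x _; rewrite -sumEFin; apply: eq_bigr => i _.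
by rewrite -EFinM mulrCA.
Qed.

Lemma bounded_moments_integrable d (T : measurableType d)
    (m : {measure set T -> \bar R}) (D : set T) (w y : T -> R) (h : T -> R) :
  measurable D -> measurable_fun D w -> measurable_fun D h ->
  (forall x, D x -> 0 <= w x)%R -> (forall x, D x -> 0 <= h x <= 1)%R ->
  \int[m]_(x in D) (w x)%:E < +oo ->
  m.-integrable D (fun x => (w x * h x)%:E).
Proof.
move=> mD mw mh w0 h01 wfin.
apply: (@le_integrable _ _ _ m D mD _ (EFin \o w)).
- by apply/measurable_EFinP; exact: measurable_funM.
- move=> x Dx; have /andP[h0 h1] := h01 x Dx; have wx := w0 x Dx.
  by rewrite /= lee_fin !ger0_norm ?mulr_ge0 // ler_piMr.
- apply/integrableP; split; first exact/measurable_EFinP.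
  rewrite (eq_integral (fun x => (w x)%:E)) // => x /set_mem Dx.
  by rewrite /= ger0_norm // w0.
Qed.

Context d1 (T1 : measurableType d1) (m1 : {measure set T1 -> \bar R}).
Context d2 (T2 : measurableType d2) (m2 : {measure set T2 -> \bar R}).
Variables (D1 : set T1) (D2 : set T2) (w1 y1 : T1 -> R) (w2 y2 : T2 -> R).

(** Equal moments give equal integrals of every polynomial in y, in particular of the step
    polynomials, which converge dominated by the integrable weight. The measures themselves may be
    infinite. *)
Lemma moment_uniqueness : measurable D1 -> measurable D2 ->
  measurable_fun D1 w1 -> measurable_fun D1 y1 ->
  measurable_fun D2 w2 -> measurable_fun D2 y2 ->
  (forall x, D1 x -> 0 <= w1 x)%R -> (forall x, D1 x -> 0 <= y1 x <= 1)%R ->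
  (forall x, D2 x -> 0 <= w2 x)%R -> (forall x, D2 x -> 0 <= y2 x <= 1)%R ->
  \int[m1]_(x in D1) (w1 x)%:E < +oo ->
  (forall n, \int[m1]_(x in D1) (w1 x * y1 x ^+ n)%:E =
             \int[m2]_(x in D2) (w2 x * y2 x ^+ n)%:E) ->
  forall a, (0 < a)%R ->
  \int[m1]_(x in D1) (w1 x * (y1 x < a)%R%:R)%:E =
  \int[m2]_(x in D2) (w2 x * (y2 x < a)%R%:R)%:E.
Proof.
move=> mD1 mD2 mw1 my1 mw2 my2 w10 y1_01 w20 y2_01 fin1 moments a a0.
have fin2 : \int[m2]_(x in D2) (w2 x)%:E < +oo.
  have := moments 0%N.
  under eq_integral do rewrite expr0 mulr1.
  by under [in RHS]eq_integral do rewrite expr0 mulr1; move=> <-.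
have stepE d (T : measurableType d) (m : {measure set T -> \bar R})
    (D : set T) (w y : T -> R) : measurable D ->
    measurable_fun D w -> measurable_fun D y ->
    (forall x, D x -> 0 <= w x)%R -> (forall x, D x -> 0 <= y x <= 1)%R ->
    \int[m]_(x in D) (w x)%:E < +oo ->
    \int[m]_(x in D) (w x * (step_poly a k).[y x])%:E @[k --> \oo] -->
    \int[m]_(x in D) (w x * (y x < a)%R%:R)%:E.
  move=> mD mw my w0 y01 fin.
  have mp k : measurable_fun D (fun x => (step_poly a k).[y x]).
    apply: (@measurableT_comp _ _ _ _ _ _ (fun z => (step_poly a k).[z])) => //.
    apply: continuous_measurable_fun; exact: continuous_horner.
  have [] := @dominated_convergence _ _ _ m D mD
    (fun k x => (w x * (step_poly a k).[y x])%:E)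
    (fun x => (w x * (y x < a)%R%:R)%:E) (EFin \o w).
  - by move=> k; apply/measurable_EFinP; exact: measurable_funM.
  - apply/measurable_EFinP; apply: measurable_funM => //.
    apply: (@measurableT_comp _ _ _ _ _ _ (fun z : R => (z < a)%R%:R : R)) => //.
    rewrite (_ : (fun z => _) = \1_(`]-oo, a[%classic)).
      exact: measurable_indic.
    by apply/funext => z; rewrite indicE mem_setE in_itv.
  - apply/aeW => x Dx; apply: cvg_EFin; first exact: nearW.
    by apply: cvgMr; apply: cvg_step_poly => //; exact: y01.
  - apply/integrableP; split; first exact/measurable_EFinP.
    rewrite (eq_integral (fun x => (w x)%:E)) // => x /set_mem Dx.
    by rewrite /= ger0_norm // w0.
  - apply/aeW => x k Dx; have /andP[h0 h1] := step_poly01 a k (y01 x Dx).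
    have wx := w0 x Dx.
    by rewrite /= lee_fin ger0_norm ?mulr_ge0 // ler_piMr.
  - by [].
have int1 i : m1.-integrable D1 (fun x => (w1 x * y1 x ^+ i)%:E).
  apply: bounded_moments_integrable => //; first exact: measurable_funX.
  by move=> x /y1_01 /andP[? ?]; rewrite exprn_ge0 // exprn_ile1.
have int2 i : m2.-integrable D2 (fun x => (w2 x * y2 x ^+ i)%:E).
  apply: bounded_moments_integrable => //; first exact: measurable_funX.
  by move=> x /y2_01 /andP[? ?]; rewrite exprn_ge0 // exprn_ile1.
have /(cvg_unique (@ereal_hausdorff R)) :=
  stepE _ _ m1 D1 w1 y1 mD1 mw1 my1 w10 y1_01 fin1.
apply; have := stepE _ _ m2 D2 w2 y2 mD2 mw2 my2 w20 y2_01 fin2.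
apply: cvg_trans; apply: near_eq_cvg; apply: nearW => k.
rewrite !integral_horner //; apply: eq_bigr => i _.
by rewrite moments.
Qed.

End moments.

(** * Gamma integrals *)

Section affine_substitution.
Local Open Scope ereal_scope.
Context {R : realType}.
Local Notation mu := (@lebesgue_measure R).

Lemma measurable_affine (k b : R) : measurable_fun setT (fun x : R => k * x + b)%R.
Proof. by apply: measurable_funD => //; exact: measurable_funM. Qed.

Lemma ge0_integral_affine (k b : R) (D : set R) (f : R -> \bar R) :
  (0 < k)%R -> measurable D -> measurable_fun D f ->
  (forall x, D x -> 0 <= f x) ->
  \int[mu]_(x in D) f x =
  k%:E * \int[mu]_(x in [set x | D (k * x + b)%R]) f (k * x + b)%R.
Proof.
move=> k0 mD mf f0.
pose phi : measurableTypeR R -> measurableTypeR R := (fun x => k * x + b)%R.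
have mphi : measurable_fun setT phi by exact: measurable_affine.
pose kk : {nonneg R} := NngNum (ltW k0).
(* Lebesgue measure is determined by its values on bounded intervals, and there the scaled image
   measure agrees with it. *)
have muE A : measurable A -> mu A = mscale kk (pushforward mu phi) A.
  move=> mA; apply: (@lebesgue_measure_unique _ (mscale kk (pushforward mu phi))) => //.
  move=> _ [[x y] /= xy <-]; rewrite /mscale /= /pushforward.
  rewrite (_ : phi @^-1` _ = `](x - b) / k, (y - b) / k]%classic)%R; last first.
    apply/seteqP; split=> z /=; rewrite !in_itv /= /phi.
      by rewrite ltr_pdivrMr // ler_pdivlMr // ltrBlDr lerBrDr mulrC.
    by rewrite ltr_pdivrMr // ler_pdivlMr // ltrBlDr lerBrDr mulrC.
  rewrite !lebesgue_measure_itv /= !lte_fin ltr_pM2r ?invr_gt0 // ltrD2r.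
  case: ifPn => _; last by rewrite mule0.
  by rewrite -!EFinB -EFinM; congr _%:E; field; rewrite gt_eqF.
rewrite (eq_measure_integral (mscale kk (pushforward mu phi))); last first.
  by move=> A mA _; exact: muE.
rewrite ge0_integral_mscale //; congr (_ * _).
by rewrite (ge0_integral_pushforward mphi) // => x /set_mem; exact: f0.
Qed.

End affine_substitution.

(** * Tonelli's theorem on a product of domains, by extension with 0 *)

Section tonelli_on_domains.
Local Open Scope ereal_scope.
Context {R : realType}.
Context d1 (T1 : measurableType d1) (m1 : {sigma_finite_measure set T1 -> \bar R}).
Context d2 (T2 : measurableType d2) (m2 : {sigma_finite_measure set T2 -> \bar R}).

Let setX_patch (D1 : set T1) (D2 : set T2) (f : T1 * T2 -> \bar R) x y :
  (f \_ (D1 `*` D2)) (x, y) =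
  if x \in D1 then (if y \in D2 then f (x, y) else 0) else 0.
Proof.
by rewrite patchE in_setX /=; case: (x \in D1); case: (y \in D2).
Qed.

Variables (D1 : set T1) (D2 : set T2) (f : T1 * T2 -> \bar R).
Hypotheses (mD1 : measurable D1) (mD2 : measurable D2).
Hypothesis mf : measurable_fun (D1 `*` D2) f.
Hypothesis f0 : forall z, (D1 `*` D2) z -> 0 <= f z.

Let mD : measurable (D1 `*` D2). Proof. exact: measurableX. Qed.

Let g := f \_ (D1 `*` D2).

Let mg : measurable_fun setT g.
Proof. exact/(measurable_restrictT f mD). Qed.

Let g0 z : 0 <= g z. Proof. exact: erestrict_ge0. Qed.

Let iterated12 : \int[m1]_x \int[m2]_y g (x, y) =
  \int[m1]_(x in D1) \int[m2]_(y in D2) f (x, y).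
Proof.
rewrite [RHS]integral_mkcond; apply: eq_integral => x _.
rewrite patchE; case: ifPn => xD; last first.
  by under eq_integral do rewrite /g setX_patch (negbTE xD); rewrite integral0.
rewrite [RHS]integral_mkcond; apply: eq_integral => y _.
by rewrite /g setX_patch xD patchE.
Qed.

Lemma integral_setX : \int[m1 \x m2]_(z in D1 `*` D2) f z =
  \int[m1]_(x in D1) \int[m2]_(y in D2) f (x, y).
Proof. by rewrite integral_mkcond -iterated12 -fubini_tonelli1. Qed.

Lemma tonelli_on :
  \int[m1]_(x in D1) \int[m2]_(y in D2) f (x, y) =
  \int[m2]_(y in D2) \int[m1]_(x in D1) f (x, y).
Proof.
rewrite -iterated12 (@fubini_tonelli _ _ _ _ _ m1 m2 g mg g0).
rewrite [RHS]integral_mkcond; apply: eq_integral => y _.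
rewrite patchE; case: ifPn => yD; last first.
  under eq_integral do rewrite /g setX_patch (negbTE yD) if_same.
  by rewrite integral0.
rewrite [RHS]integral_mkcond; apply: eq_integral => x _.
by rewrite /g setX_patch yD patchE.
Qed.

Lemma measurable_integral_setX :
  measurable_fun D2 (fun y => \int[m1]_(x in D1) f (x, y)).
Proof.
apply: (@eq_measurable_fun _ _ _ _ _ (fun y => \int[m1]_x g (x, y))).
  move=> y yD; rewrite [RHS]integral_mkcond; apply: eq_integral => x _.
  by rewrite /g setX_patch yD patchE.
apply: measurable_funTS; exact: measurable_fun_fubini_tonelli_G.
Qed.

End tonelli_on_domains.

Section gamma_integrals.
Context {R : realType}.
Local Notation mu := (@lebesgue_measure R).
Local Notation pos := (`]0, +oo[%classic : set R).

Lemma in_pos (x : R) : pos x -> 0 < x.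
Proof. by rewrite /= in_itv /= andbT. Qed.

Lemma integral_expR (l : R) : 0 < l ->
  (\int[mu]_(x in pos) (expR (- (l * x)))%:E = (l^-1)%:E)%E.
Proof.
move=> l0; have := integral_exponential_pdf l0.
rewrite -[X in integral _ _ X]/(EFin \o ((fun x => l * expR (- l * x)) \_ `[0, +oo[)).
rewrite -restrict_EFin -integral_mkcond -integral_itv_obnd_cbnd; last first.
  apply/measurable_EFinP; apply: measurable_funM => //.
  apply: measurableT_comp => //; exact: measurable_funM.
move=> h; rewrite -[LHS]mul1e -{1}(mulVf (lt0r_neq0 l0)) EFinM -muleA.
rewrite -ge0_integralZl_EFin ?ltW //; last first.
  apply/measurable_EFinP; apply: measurableT_comp => //.
  by apply: measurable_funN; exact: measurable_funM.
rewrite -[RHS]mule1; congr (_ * _)%E; rewrite -[RHS]h.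
by apply: eq_integral => x _; rewrite -EFinM /= mulNr.
Qed.

Lemma measurable_pow_exp (a l : R) (D : set R) :
  measurable_fun D (fun x => x `^ (a - 1) * expR (- (l * x))).
Proof.
apply: measurable_funTS; apply: measurable_funM; first exact: (@measurable_powR R (a - 1)).
by apply: measurableT_comp => //; apply: measurable_funN; exact: measurable_funM.
Qed.

Lemma measurable_gamma_integrand (a : R) (D : set R) :
  measurable_fun D (fun x => (x `^ (a - 1) * expR (- x))%:E).
Proof.
apply/measurable_EFinP; have := @measurable_pow_exp a 1 D.
by under eq_fun do rewrite mul1r.
Qed.

Lemma measurable_powR_EFin (b : R) (D : set R) :
  measurable_fun D (fun x => (x `^ b)%:E).
Proof. by apply/measurable_EFinP; apply: measurable_funTS; exact: measurable_powR. Qed.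

(** The antiderivative is x^a / a. Staying away from 0 avoids the singularity; the bound does not
    depend on e. *)
Lemma integral_powR_le (a e : R) : 0 < a -> 0 < e < 1 ->
  (\int[mu]_(x in `[e, 1%R]) (x `^ (a - 1))%:E <= (a^-1)%:E)%E.
Proof.
move=> a0 /andP[e0 e1].
have dF (x : R) : 0 < x -> is_derive x 1 (fun y : R => a^-1 * y `^ a) (x `^ (a - 1)).
  move=> x0; have h := is_derive1_powR a x0.
  have := @is_deriveZ R _ _ (fun y : R => y `^ a) a^-1 x 1 _ h.
  rewrite (_ : a^-1 *: (a * x `^ (a - 1)) = x `^ (a - 1)) //.
  by rewrite /GRing.scale /= mulrA mulVf ?mul1r // gt_eqF.
have cF (b x : R) : 0 < x -> {for x, continuous (fun y : R => y `^ b)}.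
  move=> x0; apply: differentiable_continuous; apply/derivable1_diffP.
  by apply: derivable_powR; rewrite in_itv /= andbT.
rewrite (@continuous_FTC2 _ _ (fun x => a^-1 * x `^ a)) //.
- rewrite powR1 mulr1 -EFinB lee_fin gerBl mulr_ge0 ?powR_ge0 //.
  by rewrite invr_ge0 ltW.
- apply: continuous_in_subspaceT => x; rewrite inE /= in_itv /= => /andP[ex _].
  by apply: cF; exact: lt_le_trans ex.
- split.
  + move=> x; rewrite in_itv /= => /andP[ex _].
    by have := dF x (lt_trans e0 ex); case.
  + apply: cvg_at_right_filter; apply: cvgM; first exact: cvg_cst.
    exact: cF.
  + by apply: cvg_at_left_filter; apply: cvgM; [exact: cvg_cst|exact: cF].
- move=> x; rewrite in_itv /= => /andP[ex _].
  by rewrite derive1E; have := dF x (lt_trans e0 ex); case.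
Qed.

Lemma integral_powR_01 (a : R) : 0 < a ->
  (\int[mu]_(x in `]0%R, 1%R]) (x `^ (a - 1))%:E <= (a^-1)%:E)%E.
Proof.
move=> a0; pose F n : set R := `[mesh n.+1, 1]%classic.
have FE n x : F n x = (mesh n.+1 <= x <= 1) :> Prop by rewrite /F /= in_itv.
have mm (n m : nat) : (n <= m)%N -> mesh m <= mesh n :> R.
  by move=> nm; rewrite /mesh lef_pV2 ?posrE // ler_nat ltnS.
have bigF : \bigcup_n F n = `]0, 1]%classic.
  apply/seteqP; split=> [x [n _]|x]; rewrite ?FE /= in_itv /=.
    by move=> /andP[nx ->]; rewrite (lt_le_trans _ nx) ?mesh_gt0.
  move=> /andP[x0 x1].
  have h : \forall n \near \oo, mesh n < x by exact: (cvgr_lt _ cvg_mesh).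
  have [n _ nP] := h; exists n => //; rewrite FE x1 andbT ltW //.
  by apply: nP; exact: leqnSn.
have cv : (\int[mu]_(x in F i) (x `^ (a - 1))%:E @[i --> \oo] -->
    \int[mu]_(x in `]0%R, 1%R]) (x `^ (a - 1))%:E)%E.
  rewrite -bigF; apply: ge0_nondecreasing_set_cvg_integral.
  - move=> n m nm; apply/subsetPset => x; rewrite !FE.
    by move=> /andP[nx ->]; rewrite andbT (le_trans _ nx) // mm.
  - by move=> n; exact: measurable_itv.
  - by move=> n; exact: measurable_powR_EFin.
  - by move=> n x _; rewrite lee_fin powR_ge0.
rewrite -(cvg_lim _ cv) //; apply: lime_le; first exact: cvgP cv.
apply: nearW => n; apply: integral_powR_le => //; rewrite mesh_gt0 /=.
by rewrite /mesh invf_lt1 ?ltr1n.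
Qed.

(** The integrand is at most x^(a - 1) up to 1, and at most e^(-x) beyond, as a <= 1. *)
Lemma gamma_finite (a : R) : 0 < a <= 1 ->
  (\int[mu]_(x in pos) (x `^ (a - 1) * expR (- x))%:E < +oo)%E.
Proof.
move=> /andP[a0 a1].
have posE : pos = `]0, 1]%classic `|` `]1, +oo[%classic.
  by rewrite -itv_bndbnd_setU // bnd_simp.
rewrite posE ge0_integral_setU //=; last 3 first.
- exact: measurable_gamma_integrand.
- by move=> x _; rewrite lee_fin mulr_ge0 ?powR_ge0 ?expR_ge0.
- apply/disj_setPLR => x /=; rewrite !in_itv /= andbT => /andP[_ x1].
  by apply/negP; rewrite -leNgt.
apply: lte_add_pinfty.
  apply: (le_lt_trans _ (ltry a^-1)); 
  apply: (@le_trans _ _ (\int[mu]_(x in `]0%R, 1%R]) (x `^ (a - 1))%:E)%E);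
    last exact: integral_powR_01.
  apply: ge0_le_integral => //.
  - by move=> x _; rewrite lee_fin mulr_ge0 ?powR_ge0 ?expR_ge0.
  - exact: measurable_gamma_integrand.
  - exact: measurable_powR_EFin.
  - move=> x; rewrite /= in_itv /= => /andP[x0 _]; rewrite lee_fin.
    by rewrite ler_piMr ?powR_ge0 // expR_le1 oppr_le0 ltW.
apply: (@le_lt_trans _ _ (\int[mu]_(x in pos) (expR (- (1 * x)))%:E)%E); last first.
  by rewrite integral_expR // ltry.
have me (D : set R) : measurable_fun D (fun x => (expR (- (1 * x)))%:E).
  apply/measurable_EFinP; apply: measurable_funTS; apply: measurableT_comp => //.
  by apply: measurable_funN; exact: measurable_funM.
apply: (@le_trans _ _ (\int[mu]_(x in `]1%R, +oo[) (expR (- (1 * x)))%:E)%E).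
  apply: ge0_le_integral => //.
  - by move=> x _; rewrite lee_fin mulr_ge0 ?powR_ge0 ?expR_ge0.
  - exact: measurable_gamma_integrand.
  - exact: me.
  - move=> x; rewrite /= in_itv /= andbT => x1; rewrite lee_fin mul1r.
    rewrite ler_piMl ?expR_ge0 // -[leRHS](powRr0 x).
    by apply: ler_powR; [exact: ltW|rewrite subr_le0].
apply: ge0_subset_integral => //.
- exact: me.
- by move=> x /=; rewrite !in_itv /= !andbT; exact: lt_trans.
Qed.

(** [gamma_function] is a real integral, which would be 0 if the extended one were infinite;
    finiteness identifies the two. *)
Lemma gammaE (a : R) : 0 < a <= 1 ->
  (\int[mu]_(x in pos) (x `^ (a - 1) * expR (- x))%:E = (gamma_function a)%:E)%E.
Proof.
move=> a01; rewrite /gamma_function /Rintegral fineK //.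
rewrite ge0_fin_numE; first exact: gamma_finite.
by apply: integral_ge0 => x _; rewrite lee_fin mulr_ge0 ?powR_ge0 ?expR_ge0.
Qed.

(** On ]0, 1] the integrand is at least e^(-1). *)
Lemma gamma_gt0 (a : R) : 0 < a <= 1 -> 0 < gamma_function a.
Proof.
move=> a01; have /andP[a0 a1] := a01; rewrite -lte_fin -gammaE //.
apply: (@lt_le_trans _ _ (\int[mu]_(x in `]0%R, 1%R]) (cst (expR (-1))%:E x))%E).
  rewrite integral_cst //= lebesgue_measure_itv /= lte_fin ltr01 oppr0 adde0 mule1.
  by rewrite lte_fin expR_gt0.
apply: (@le_trans _ _ (\int[mu]_(x in `]0%R, 1%R]) (x `^ (a - 1) * expR (- x))%:E)%E).
  apply: ge0_le_integral => //.
  - by move=> x _; rewrite lee_fin expR_ge0.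
  - exact: measurable_gamma_integrand.
  - move=> x; rewrite /= in_itv /= => /andP[x0 x1]; rewrite lee_fin.
    rewrite -[leLHS]mul1r ler_pM ?expR_ge0 // ?ler_expR ?lerN2 //.
    rewrite -[leLHS](powRr0 x).
    by apply: ger_powR; [rewrite x0|rewrite subr_le0].
apply: ge0_subset_integral => //.
- exact: measurable_gamma_integrand.
- by move=> x _; rewrite lee_fin mulr_ge0 ?powR_ge0 ?expR_ge0.
- by move=> x /=; rewrite !in_itv /= => /andP[-> _].
Qed.

Lemma gamma1 : gamma_function (1 : R) = 1.
Proof.
apply: EFin_inj; rewrite -gammaE ?ltr01 ?lexx //.
transitivity (\int[mu]_(x in pos) (expR (- (1 * x)))%:E)%E; last first.
  by rewrite integral_expR // invr1.
by apply: eq_integral => x _; rewrite subrr powRr0 !mul1r.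
Qed.

Lemma integral_pow_exp (a l : R) : 0 < a <= 1 -> 0 < l ->
  (\int[mu]_(x in pos) (x `^ (a - 1) * expR (- (l * x)))%:E =
   (gamma_function a * l `^ (- a))%:E)%E.
Proof.
move=> a01 l0; have /andP[a0 a1] := a01.
rewrite EFinM -gammaE // [X in _ = (X * _)%E](@ge0_integral_affine _ l 0 pos) //=; last 2 first.
- exact: measurable_gamma_integrand.
- by move=> x _; rewrite lee_fin mulr_ge0 ?powR_ge0 ?expR_ge0.
have -> : [set x | (l * x + 0) \in `]0, +oo[] = pos.
  by apply/seteqP; split=> x /=; rewrite !in_itv /= !andbT addr0 pmulr_rgt0.
rewrite [X in (_ * X * _)%E](_ : _ = \int[mu]_(x in pos)
    ((l `^ (a - 1))%:E * (x `^ (a - 1) * expR (- (l * x)))%:E)%E)%E; last first.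
  apply: eq_integral.
  move=> x /set_mem /in_pos x0; rewrite -EFinM addr0 powRM ?ltW //.
  by rewrite mulrA.
rewrite ge0_integralZl_EFin ?powR_ge0 //; last 2 first.
- by move=> x _; rewrite lee_fin mulr_ge0 ?powR_ge0 ?expR_ge0.
- by apply/measurable_EFinP; exact: measurable_pow_exp.
rewrite muleA -EFinM mulr_powRB1 ?ltW // muleC muleA -EFinM powRN mulVf ?mul1e //.
by rewrite gt_eqF // powR_gt0.
Qed.

End gamma_integrals.

(** * Mass and Laplace transform of the aging density *)

Section aging_density_integrals.
Context {R : realType}.
Local Notation mu := (@lebesgue_measure R).
Local Notation pos := (`]0, +oo[%classic : set R).
Variables (alpha t : R).
Hypotheses (alpha01 : 0 < alpha < 1) (t_gt0 : 0 < t).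

Let alpha01' : 0 < alpha <= 1.
Proof. by have /andP[-> /ltW] := alpha01. Qed.

Let alphaC01 : 0 < 1 - alpha <= 1.
Proof. by have /andP[a0 a1] := alpha01; rewrite subr_gt0 a1 gerBl ltW. Qed.

Let Ga_gt0 := gamma_gt0 alpha01'.
Let GC_gt0 := gamma_gt0 alphaC01.

Let coef_ge0 :
  0 <= t `^ alpha / (t * (gamma_function (1 - alpha) * gamma_function alpha)).
Proof.
exact: (divr_ge0 (powR_ge0 _ _)
  (mulr_ge0 (ltW t_gt0) (mulr_ge0 (ltW GC_gt0) (ltW Ga_gt0)))).
Qed.

(** Isolates the power x^((1 - alpha) - 1) of a Gamma integrand; the denominator of the Beta
    function is Gamma(1) = 1. *)
Lemma aging_densityE x : 0 < x ->
  aging_density alpha t x =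
  t `^ alpha / (t * (gamma_function (1 - alpha) * gamma_function alpha)) *
  (x `^ ((1 - alpha) - 1) * (1 + x / t)^-1).
Proof.
move=> x0; rewrite /aging_density /beta_function subrK gamma1 divr1.
rewrite (_ : 1 - alpha - 1 = - alpha); last by ring.
have -> : (x / t) `^ (- alpha) = x `^ (- alpha) * t `^ alpha.
  rewrite powRM ?ltW ?invr_gt0 // -(powR_inv1 (ltW t_gt0)) -powRrM.
  by rewrite mulrNN mul1r.
by ring.
Qed.

Lemma aging_density_ge0 x : 0 < x -> 0 <= aging_density alpha t x.
Proof.
move=> x0; rewrite aging_densityE //.
apply: (mulr_ge0 coef_ge0).
by rewrite mulr_ge0 ?powR_ge0 // invr_ge0 addr_ge0 // divr_ge0 // ltW.
Qed.

Lemma measurable_aging_density : measurable_fun pos (aging_density alpha t).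
Proof.
apply: (@eq_measurable_fun _ _ R R pos (fun x : R => (x / t) `^ (- alpha) *
    (1 + x / t) `^ (- 1) / (t * beta_function (1 - alpha) alpha))).
  move=> x /set_mem /in_pos x0.
  by rewrite /aging_density powR_inv1 // addr_ge0 // divr_ge0 // ltW.
apply: measurable_funTS; apply: measurable_funM => //.
have mpow b (g : R -> R) : measurable_fun setT g -> measurable_fun setT (fun x => g x `^ b).
  by move=> mg; apply: (measurableT_comp (f := fun y : R => y `^ b)) => //; exact: measurable_powR.
apply: measurable_funM; apply: mpow; first exact: measurable_funM.
by apply: measurable_funD => //; exact: measurable_funM.
Qed.

(* Tonelli, after writing (1 + x / t)^-1 as the integral of e^(- v (1 + x / t)). *)
Lemma aging_density_laplace q : 0 <= q ->
  (\int[mu]_(x in pos) (expR (- (q * x)) * aging_density alpha t x)%:E =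
   (t `^ (alpha - 1) / gamma_function alpha)%:E *
   \int[mu]_(v in pos) (expR (- v) * (q + v / t) `^ (alpha - 1))%:E)%E.
Proof.
move=> q0.
pose C := t `^ alpha / (t * (gamma_function (1 - alpha) * gamma_function alpha)).
have C0 : 0 <= C := coef_ge0.
pose f (z : R * R) := C * (z.1 `^ ((1 - alpha) - 1) *
  expR (- (q * z.1)) * expR (- ((1 + z.1 / t) * z.2))).
have f0 z : 0 <= f z.
  apply: (mulr_ge0 C0).
  exact: (mulr_ge0 (mulr_ge0 (powR_ge0 _ _) (expR_ge0 _)) (expR_ge0 _)).
have mf (D : set (R * R)) : measurable_fun D (fun z => (f z)%:E).
  apply/measurable_EFinP; apply: measurable_funTS; apply: measurable_funM => //.
  apply: measurable_funM; first apply: measurable_funM.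
  - by apply: (measurableT_comp (f := fun y : R => y `^ _)) => //; exact: measurable_powR.
  - by apply: measurableT_comp => //; apply: measurable_funN; apply: measurable_funM.
  - apply: measurableT_comp => //; apply: measurable_funN; apply: measurable_funM => //.
    by apply: measurable_funD => //; exact: measurable_funM.
transitivity (\int[mu]_(x in pos) \int[mu]_(v in pos) (f (x, v))%:E)%E.
  apply: eq_integral => x /set_mem /in_pos x0; rewrite /f /=.
  have l0 : 0 < 1 + x / t by rewrite addr_gt0 // divr_gt0.
  under eq_integral do rewrite mulrA EFinM.
  rewrite ge0_integralZl_EFin //; last 2 first.
  - apply/measurable_EFinP; apply: measurableT_comp => //.
    by apply: measurable_funN; exact: measurable_funM.
  - exact: (mulr_ge0 C0 (mulr_ge0 (powR_ge0 _ _) (expR_ge0 _))).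
  rewrite integral_expR // -EFinM aging_densityE // -/C; congr _%:E.
  by ring.
rewrite (@tonelli_on _ _ _ lebesgue_measure _ _ lebesgue_measure pos pos
  (fun z => (f z)%:E)) //; last 2 first.
- exact: mf.
- by move=> z _; rewrite lee_fin.
rewrite -ge0_integralZl_EFin //; last 3 first.
- by move=> v _; rewrite lee_fin mulr_ge0 ?powR_ge0 ?expR_ge0.
- apply/measurable_EFinP; apply: measurable_funTS; apply: measurable_funM.
    by apply: measurableT_comp => //; exact: measurable_funN.
  apply: (measurableT_comp (f := fun y : R => y `^ _)); first exact: measurable_powR.
  by apply: measurable_funD => //; exact: measurable_funM.
- exact: (divr_ge0 (powR_ge0 _ _) (ltW Ga_gt0)).
apply: eq_integral => v /set_mem /in_pos v0; rewrite /f /=.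
have l0 : 0 < q + v / t by rewrite ltr_wpDl // divr_gt0.
transitivity (\int[mu]_(x in pos) ((C * expR (- v))%:E *
    (x `^ ((1 - alpha) - 1) * expR (- ((q + v / t) * x)))%:E))%E.
  apply: eq_integral => x _; rewrite -EFinM; congr _%:E.
  rewrite (_ : - ((1 + x / t) * v) = - v + - (v / t * x)); last by ring.
  rewrite (_ : - ((q + v / t) * x) = - (q * x) + - (v / t * x)); last by ring.
  by rewrite !expRD; ring.
have Cv0 : 0 <= C * expR (- v) := mulr_ge0 C0 (expR_ge0 _).
rewrite ge0_integralZl_EFin //; last 2 first.
- by move=> x _; rewrite lee_fin mulr_ge0 ?powR_ge0 ?expR_ge0.
- by apply/measurable_EFinP; exact: measurable_pow_exp.
rewrite integral_pow_exp // -!EFinM opprB; congr _%:E.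
rewrite /C [t `^ (alpha - 1)]powRB; last by rewrite lt0r_neq0 // implybT.
rewrite (powRr1 (ltW t_gt0)); field.
by rewrite (gt_eqF Ga_gt0) (gt_eqF GC_gt0) (gt_eqF t_gt0).
Qed.

(** The case q = 0 of the Laplace transform, where the remaining integral is a multiple of
    Gamma(alpha). *)
Lemma aging_density_total : (\int[mu]_(x in pos) (aging_density alpha t x)%:E = 1)%E.
Proof.
have := aging_density_laplace (lexx 0).
under eq_integral do rewrite mul0r oppr0 expR0 mul1r.
move=> ->; have /andP[a0 a1] := alpha01.
transitivity ((t `^ (alpha - 1) / gamma_function alpha)%:E *
  \int[mu]_(v in pos) ((t `^ (1 - alpha))%:E * (v `^ (alpha - 1) * expR (- v))%:E))%E.
  congr (_ * _)%E; apply: eq_integral => v /set_mem /in_pos v0.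
  rewrite -EFinM add0r powRM ?ltW ?invr_gt0 //; congr _%:E.
  rewrite -(powR_inv1 (ltW t_gt0)) -powRrM mulN1r opprB.
  by ring.
rewrite ge0_integralZl_EFin ?powR_ge0 //; last 2 first.
- by move=> v _; rewrite lee_fin mulr_ge0 ?powR_ge0 ?expR_ge0.
- exact: measurable_gamma_integrand.
rewrite gammaE // -!EFinM; congr _%:E.
have -> : t `^ (alpha - 1) = (t `^ (1 - alpha))^-1 by rewrite -powRN opprB.
by field; rewrite (gt_eqF Ga_gt0) (gt_eqF (powR_gt0 _ t_gt0)).
Qed.

(** With x = t + v / q one has q + v / t = q x / t. The result has the shape produced by the
    potential measure beyond t. *)
Lemma aging_density_laplace_tail q : 0 < q ->
  (\int[mu]_(x in pos) (expR (- (q * x)) * aging_density alpha t x)%:E =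
   (q `^ alpha / gamma_function alpha)%:E *
   \int[mu]_(x in `]t, +oo[) (x `^ (alpha - 1) * expR (- (q * (x - t))))%:E)%E.
Proof.
move=> q0; rewrite aging_density_laplace ?ltW //.
rewrite (@ge0_integral_affine _ q^-1 t `]t, +oo[%classic) ?invr_gt0 //=; last 2 first.
- apply/measurable_EFinP; apply: measurable_funTS; apply: measurable_funM.
    exact: measurable_powR.
  apply: measurableT_comp => //; apply: measurable_funN; apply: measurable_funM => //.
  exact: measurable_funB.
- by move=> x _; rewrite lee_fin mulr_ge0 ?powR_ge0 ?expR_ge0.
have -> : [set x | (q^-1 * x + t) \in `]t, +oo[] = pos.
  apply/seteqP; split=> x /=; rewrite !in_itv /= !andbT.
    by rewrite ltrDr pmulr_rgt0 ?invr_gt0.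
  by rewrite ltrDr pmulr_rgt0 ?invr_gt0.
set J := (X in _ = (_ * (_ * X))%E).
have Jge0 : (0 <= J)%E.
  by apply: integral_ge0 => v _; rewrite lee_fin mulr_ge0 ?powR_ge0 ?expR_ge0.
have -> : (\int[mu]_(v in pos) (expR (- v) * (q + v / t) `^ (alpha - 1))%:E =
    ((q / t) `^ (alpha - 1))%:E * J)%E.
  rewrite -ge0_integralZl_EFin ?powR_ge0 //; last 2 first.
  - by move=> v _; rewrite lee_fin mulr_ge0 ?powR_ge0 ?expR_ge0.
  - apply/measurable_EFinP; apply: measurable_funTS; apply: measurable_funM.
      apply: (measurableT_comp (f := fun y : R => y `^ _)); first exact: measurable_powR.
      exact: measurable_affine.
    apply: measurableT_comp => //; apply: measurable_funN; apply: measurable_funM => //.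
    by apply: measurable_funB => //; exact: measurable_affine.
  apply: eq_integral => v /set_mem /in_pos v0; rewrite -EFinM; congr _%:E.
  rewrite addrK mulVKf ?gt_eqF // mulrA -powRM.
  - by rewrite mulrC; congr (_ `^ _ * _); field; rewrite !gt_eqF.
  - by rewrite divr_ge0 // ltW.
  - by rewrite addr_ge0 ?mulr_ge0 ?invr_ge0 // ltW.
rewrite !muleA -!EFinM; congr (_%:E * _)%E.
rewrite powRM ?invr_ge0 ?ltW // -(powR_inv1 (ltW t_gt0)) -powRrM mulN1r.
rewrite powRN [q `^ (alpha - 1)]powRB; last by rewrite lt0r_neq0 // implybT.
rewrite (powRr1 (ltW q0)); field.
by rewrite (gt_eqF Ga_gt0) (gt_eqF q0) (gt_eqF (powR_gt0 _ t_gt0)).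
Qed.

End aging_density_integrals.

(** * Potential measure and law of the overshoot *)

Section potential.
Context d (T : measurableType d) (R : realType) (P : probability T R).
Variables (alpha c : R) (A D : R -> {RV P >-> R}).
Hypotheses (alpha01 : 0 < alpha < 1) (c_gt0 : 0 < c) (levyA : levy_process A).
Hypothesis stableD : stable_subordinator alpha c D.
Hypothesis indepAD : independent_processes A D.
Variable t0 : R.
Hypothesis t0_gt0 : 0 < t0.
Local Notation mu := (@lebesgue_measure R).
Local Notation pos := (`]0, +oo[%classic : set R).

Let alpha01' : 0 < alpha <= 1.
Proof. by have /andP[-> /ltW] := alpha01. Qed.

Let rae := regular_path_ae c_gt0 levyA stableD.

(* Truncated so that the exponentials below are bounded on all paths. *)
Definition truncated (z : R * T) : R := Num.max 0 (D `|z.1| z.2).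

Lemma measurable_truncated : measurable_fun setT truncated.
Proof.
rewrite /truncated; apply: measurable_maxr => //.
apply: (@measurable_eval _ _ (R * T)%type (fun s z => D s z.2) (fun z => `|z.1|)).
- by move=> z t t_ge0; exact: (@pair_process_right _ _ _ _ alpha c A D levyA stableD false).
- by move=> s _; exact: measurableT_comp.
- exact: measurableT_comp.
- by [].
Qed.

Lemma truncated_ge0 z : 0 <= truncated z.
Proof. by rewrite le_max lexx. Qed.

Lemma truncatedE s w : 0 <= s -> regular_path A D w -> truncated (s, w) = D s w.
Proof.
move=> s0 [_ D0 Dnd _]; rewrite /truncated /= ger0_norm // max_r //.
by rewrite -D0; exact: Dnd.
Qed.

Lemma measurable_exp_truncated (q : R) (D' : set (R * T)) :
  measurable_fun D' (fun z => expR (- (q * truncated z))).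
Proof.
apply: measurable_funTS; apply: measurableT_comp => //.
by apply: measurable_funN; apply: measurable_funM => //; exact: measurable_truncated.
Qed.

Lemma measurable_truncated_tail q (D' : set (R * T)) : measurable_fun D'
  (fun z => expR (- (q * truncated z)) * (t0 < truncated z)%R%:R).
Proof.
apply: measurable_funTS; apply: measurable_funM.
  exact: measurable_exp_truncated.
apply: (@measurableT_comp _ _ _ _ _ _ (fun z : R => (t0 < z)%R%:R : R)).
  rewrite (_ : (fun z => _) = \1_(`]t0, +oo[%classic)).
    exact: measurable_indic.
  by apply/funext => z; rewrite indicE mem_setE in_itv andbT.
exact: measurable_truncated.
Qed.

Lemma laplace_truncated s q : 0 <= s -> 0 <= q ->
  (\int[P]_w (expR (- (q * truncated (s, w))))%:E =
   (expR (- (s * c * q `^ alpha)))%:E)%E.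
Proof.
move=> s0 q0; transitivity (\int[P]_w (expR (- (q * D s w)))%:E)%E; last first.
  exact: (laplace_integral stableD).
apply: ge0_ae_eq_integral => //.
- apply/measurable_EFinP.
  apply: (@measurable_fun_pair2 _ _ _ _ _ _ (fun z => expR (- (q * truncated z)))).
  exact: measurable_exp_truncated.
- apply/measurable_EFinP; apply: measurableT_comp => //.
  by apply: measurable_funN; exact: measurable_funM.
- by apply: filterS rae => w rw _; rewrite truncatedE.
Qed.

Lemma potential_laplace q : 0 < q ->
  (\int[(mu \x P)%E]_(z in pos `*` setT) (expR (- (q * truncated z)))%:E =
   ((c * q `^ alpha)^-1)%:E)%E.
Proof.
move=> q0; rewrite integral_setX //; last first.
  by apply/measurable_EFinP; exact: measurable_exp_truncated.
transitivity (\int[mu]_(s in pos) (expR (- ((c * q `^ alpha) * s)))%:E)%E.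
  apply: eq_integral => s /set_mem /in_pos s0.
  by rewrite laplace_truncated ?ltW // [s * c]mulrC mulrAC.
by rewrite integral_expR // mulr_gt0 // powR_gt0.
Qed.

(** Moments of e^(-D) under the weight e^(-q D): the n-th one is the potential's Laplace transform
    at q + n, that is 1 / (c (q + n)^alpha), equal to the Gamma integral on the other side. The
    event e^(-D) < e^(-t_0) is D > t_0. *)
Lemma potential_tail q : 0 < q ->
  (\int[mu]_(s in pos) \int[P]_w
     (expR (- (q * truncated (s, w))) * (t0 < truncated (s, w))%R%:R)%:E =
   ((c * gamma_function alpha)^-1)%:E *
   \int[mu]_(x in `]t0, +oo[) (x `^ (alpha - 1) * expR (- (q * x)))%:E)%E.
Proof.
move=> q0; have Ga0 := gamma_gt0 alpha01'.
have k0 : 0 <= (c * gamma_function alpha)^-1 by rewrite invr_ge0 mulr_ge0 ?ltW.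
have := @moment_uniqueness R _ _ (mu \x P)%E _ _ lebesgue_measure
  (pos `*` setT) pos (fun z => expR (- (q * truncated z)))
  (fun z => expR (- truncated z))
  (fun x => (c * gamma_function alpha)^-1 * (x `^ (alpha - 1) * expR (- (q * x))))
  (fun x => expR (- x)).
move=> /(_ _ _ _ _ _ _ _ _ _ _ _ _ (expR (- t0)) (expR_gt0 _)) H.
have {}H : (\int[(mu \x P)%E]_(z in pos `*` setT) (expR (- (q * truncated z)) *
      (expR (- truncated z) < expR (- t0))%R%:R)%:E =
    \int[mu]_(x in pos) ((c * gamma_function alpha)^-1 *
      (x `^ (alpha - 1) * expR (- (q * x))) * (expR (- x) < expR (- t0))%R%:R)%:E)%E.
  apply: H.
  - exact: measurableX.
  - exact: measurable_itv.
  - exact: measurable_exp_truncated.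
  - apply: measurable_funTS; apply: measurableT_comp => //.
    by apply: measurable_funN; exact: measurable_truncated.
  - by apply: measurable_funM => //; exact: measurable_pow_exp.
  - apply: measurable_funTS; apply: measurableT_comp => //; exact: measurable_funN.
  - by move=> z _; exact: expR_ge0.
  - by move=> z _; rewrite expR_ge0 expR_le1 oppr_le0 truncated_ge0.
  - by move=> x _; rewrite mulr_ge0 // mulr_ge0 ?powR_ge0 ?expR_ge0.
  - by move=> x /in_pos x0; rewrite expR_ge0 expR_le1 oppr_le0 ltW.
  - by rewrite potential_laplace // ltry.
  - move=> n; have qn0 : 0 < q + n%:R by rewrite ltr_pwDl.
    under eq_integral.
      move=> z _; rewrite -expRM_natl -expRD.
      rewrite (_ : - (q * truncated z) + n%:R * - truncated z =
        - ((q + n%:R) * truncated z)); last by ring.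
      over.
    rewrite potential_laplace //.
    transitivity (\int[mu]_(x in pos) (((c * gamma_function alpha)^-1)%:E *
        (x `^ (alpha - 1) * expR (- ((q + n%:R) * x)))%:E))%E; last first.
      apply: eq_integral => x _; rewrite -EFinM -!mulrA -expRM_natl -expRD.
      congr (_ * (_ * expR _))%:E; ring.
    rewrite ge0_integralZl_EFin //; last 2 first.
    - by move=> x _; rewrite lee_fin mulr_ge0 ?powR_ge0 ?expR_ge0.
    - by apply/measurable_EFinP; exact: measurable_pow_exp.
    rewrite integral_pow_exp // -EFinM powRN; congr _%:E; field.
    by rewrite !gt_eqF // powR_gt0.
move: H; rewrite integral_setX //; last first.
  apply/measurable_EFinP.
  rewrite (_ : (fun z => _) = fun z => expR (- (q * truncated z)) *
    (t0 < truncated z)%R%:R); first exact: measurable_truncated_tail.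
  by apply/funext => z; rewrite ltr_expR ltrN2.
under eq_integral do under eq_integral do rewrite ltr_expR ltrN2.
move=> ->.
rewrite -ge0_integralZl_EFin //; last 2 first.
- by move=> x _; rewrite lee_fin mulr_ge0 ?powR_ge0 ?expR_ge0.
- by apply/measurable_EFinP; exact: measurable_pow_exp.
rewrite [RHS]integral_mkcond [LHS]integral_mkcond; apply: eq_integral => x _.
rewrite !patchE !mem_setE !in_itv /= !andbT ltr_expR ltrN2.
have [tx|xt] := ltP t0 x; first by rewrite (lt_trans t0_gt0 tx) mulr1 EFinM.
by rewrite mulr0 if_same.
Qed.

End potential.

(** * Laplace transform of the overshoot *)

Section overshoot_law.
Context d (T : measurableType d) (R : realType) (P : probability T R).
Variables (alpha c : R) (A D : R -> {RV P >-> R}).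
Hypotheses (alpha01 : 0 < alpha < 1) (c_gt0 : 0 < c) (levyA : levy_process A).
Hypothesis stableD : stable_subordinator alpha c D.
Hypothesis indepAD : independent_processes A D.
Variable t0 : R.
Hypothesis t0_gt0 : 0 < t0.
Local Notation mu := (@lebesgue_measure R).
Local Notation pos := (`]0, +oo[%classic : set R).
Local Notation H := (overshoot D t0).
Local Notation E := (passage_time D t0).

Let rae := regular_path_ae c_gt0 levyA stableD.

Let Dright w t : 0 <= t -> D s w @[s --> t^'+] --> D t w.
Proof. exact: (@pair_process_right _ _ _ _ alpha c A D levyA stableD false). Qed.

Lemma overshoot_ge0 w : regular_path A D w -> 0 <= H w.
Proof.
move=> [_ D0 Dnd Du]; rewrite subr_ge0.
by apply: (@le_ginv _ (D ^~ w)) => // t t_ge0; exact: Dright.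
Qed.

Lemma measurable_after_passage :
  measurable_fun setT (fun z : R * T => restart A D t0 z.2 (Some (false, z.1))).
Proof.
have mE : measurable_fun setT (fun z : R * T => E z.2).
  by apply: measurableT_comp => //; exact: (measurable_passage_time levyA stableD).
have meval (tau : R * T -> R) : measurable_fun setT tau -> (forall z, 0 <= tau z) ->
    measurable_fun setT (fun z => D (tau z) z.2).
  move=> mtau tau0; apply: (@measurable_eval _ _ (R * T)%type (fun s z => D s z.2)) => //.
  - by move=> z t t_ge0; exact: Dright.
  - by move=> s _; exact: measurableT_comp.
apply: measurable_funB; apply: meval => //.
- by apply: measurable_funD => //; exact: measurableT_comp.
- by move=> z; rewrite addr_ge0 // passage_time_ge0.
- by move=> z; exact: passage_time_ge0.
Qed.

(** Up to the point s = E, D_s > t_0 means s > E, and D_{E + s} = t_0 + H + (D_{E + s} - D_E). *)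
Lemma passage_integral q w : regular_path A D w ->
  (\int[mu]_(s in pos)
     (expR (- (q * truncated D (s, w))) * (t0 < truncated D (s, w))%R%:R)%:E =
   (expR (- (q * t0)))%:E * \int[mu]_(s in pos)
     (expR (- (q * Num.max 0 (H w))) *
      expR (- (q * Num.max 0 (restart A D t0 w (Some (false, s))))))%:E)%E.
Proof.
move=> rw; have [_ D0 Dnd Du] := rw.
have E0 : 0 <= E w := passage_time_ge0 D t0 w.
have mtr (S : set R) : measurable_fun S (fun s => (expR (- (q * truncated D (s, w))))%:E).
  apply/measurable_EFinP; apply: measurable_funTS.
  apply: (@measurable_fun_pair1 _ _ _ _ _ _ (fun z => expR (- (q * truncated D z)))).
  exact: (measurable_exp_truncated levyA stableD).
have mafter (S : set R) : measurable_fun S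
    (fun s => (expR (- (q * Num.max 0 (H w))) *
      expR (- (q * Num.max 0 (restart A D t0 w (Some (false, s))))))%:E).
  apply/measurable_EFinP; apply: measurable_funTS; apply: measurable_funM => //.
  apply: measurableT_comp => //; apply: measurable_funN; apply: measurable_funM => //.
  apply: measurable_maxr => //.
  exact: (@measurable_fun_pair1 _ _ _ _ _ _ _ w measurable_after_passage).
transitivity (\int[mu]_(s in `]E w, +oo[) (expR (- (q * truncated D (s, w))))%:E)%E.
  rewrite [RHS]integral_mkcond [LHS]integral_mkcond.
  apply: ge0_ae_eq_integral => //.
  - apply/(measurable_restrictT _ (measurable_itv _)); apply/measurable_EFinP.
    apply: measurable_funTS; apply: (@measurable_fun_pair1 _ _ _ _ _ _ (fun z =>
      expR (- (q * truncated D z)) * (t0 < truncated D z)%R%:R)).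
    exact: (measurable_truncated_tail levyA stableD).
  - by apply/(measurable_restrictT _ (measurable_itv _)); exact: mtr.
  - by move=> s _; apply: erestrict_ge0 => x _; rewrite lee_fin mulr_ge0 ?expR_ge0.
  - by move=> s _; apply: erestrict_ge0 => x _; rewrite lee_fin expR_ge0.
  (* At s = E both D = t_0 and D > t_0 are possible, but a single point is negligible. *)
  exists [set E w]; split => //; first exact: lebesgue_measure_set1.
  move=> s /=; apply: contra_notP => /eqP sE _.
  rewrite !patchE !mem_setE !in_itv /= !andbT.
  have [lt|gt|eq] := ltgtP s (E w); last by rewrite eq eqxx in sE.
    case: ifPn => // s0; rewrite (truncatedE (ltW s0) rw).
    rewrite ltNge (_ : D s w <= t0) ?mulr0 //.
    by apply: (@lt_ginv _ (D ^~ w)) => //; exact: ltW.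
  have s0 : 0 < s by exact: le_lt_trans gt.
  rewrite s0 (truncatedE (ltW s0) rw) (_ : t0 < D s w) ?mulr1 //.
  by apply: (@ginv_lt _ (D ^~ w)).
rewrite (@ge0_integral_affine _ 1 (E w)) //.
rewrite mul1e (_ : [set x | _] = pos); last first.
  by apply/seteqP; split=> x /=; rewrite !in_itv /= !andbT mul1r ltrDr.
rewrite -ge0_integralZl_EFin ?expR_ge0 //; last first.
  exact: mafter.
apply: eq_integral => s /set_mem /in_pos s0; rewrite -EFinM -!expRD mul1r; congr (expR _)%:E.
have r0 : 0 <= restart A D t0 w (Some (false, s)).
  by rewrite /= subr_ge0; apply: Dnd => //; rewrite lerDl.
rewrite (max_r (overshoot_ge0 rw)) (max_r r0).
rewrite (truncatedE (addr_ge0 (ltW s0) E0) rw) /restart /overshoot /= ger0_norm ?ltW //.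
by rewrite [s + _]addrC; ring.
Qed.

Lemma restart_laplace q s : 0 <= q -> 0 <= s ->
  (\int[P]_w (expR (- (q * Num.max 0 (H w))) *
     expR (- (q * Num.max 0 (restart A D t0 w (Some (false, s))))))%:E =
   (\int[P]_w (expR (- (q * Num.max 0 (H w))))%:E) *
   (expR (- (s * c * q `^ alpha)))%:E)%E.
Proof.
move=> q0 s0; pose I := option (bool * R).
pose f (v : g_sigma_algebraType (@cylinders R I)) : \bar R :=
  (expR (- (q * Num.max 0 ((v : I -> R) None))) *
   expR (- (q * Num.max 0 ((v : I -> R) (Some (false, s))))))%:E.
have mexp d' (T' : measurableType d') (g : T' -> R) : measurable_fun setT g ->
    measurable_fun setT (fun x => expR (- (q * Num.max 0 (g x)))).
  move=> mg; apply: measurableT_comp => //; apply: measurable_funN.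
  by apply: measurable_funM => //; exact: measurable_maxr.
have mf : measurable_fun setT f.
  by apply/measurable_EFinP; apply: measurable_funM; apply: mexp; exact: measurable_coordinate.
have f0 v : (0 <= f v)%E by rewrite lee_fin mulr_ge0 ?expR_ge0.
have := @family_law_integral _ _ _ _ P _ _ (P \x P)%E (restart A D t0)
  (fun w : T * T => fresh A D t0 w.1 w.2)
  (measurable_restart levyA stableD t0) (measurable_fresh levyA stableD t0) f
  (restart_law c_gt0 levyA stableD indepAD (ltW t0_gt0)) mf f0.
rewrite /f /= => ->.
have mH := measurable_overshoot levyA stableD t0.
have mg : measurable_fun setT (fun z : T * T =>
    (expR (- (q * Num.max 0 (H z.1))) *
     expR (- (q * Num.max 0 (D `|s| z.2))))%:E).
  apply/measurable_EFinP; apply: measurable_funM; apply: mexp.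
    exact: measurableT_comp.
  exact: measurableT_comp.
rewrite fubini_tonelli1 //.
rewrite -ge0_integralZr //; last first.
  by apply/measurable_EFinP; exact: mexp.
apply: eq_integral => w _; rewrite /fubini_F /=.
under eq_integral do rewrite EFinM.
rewrite ge0_integralZl_EFin ?expR_ge0 //; last by apply/measurable_EFinP; exact: mexp.
by congr (_ * _)%E; exact: (laplace_truncated c_gt0 levyA stableD).
Qed.

Lemma overshoot_laplace q : 0 < q ->
  (\int[P]_w (expR (- (q * Num.max 0 (H w))))%:E =
   \int[mu]_(x in pos) (expR (- (q * x)) * aging_density alpha t0 x)%:E)%E.
Proof.
move=> q0; have /andP[a0 a1] := alpha01.
have Ga0 : 0 < gamma_function alpha by rewrite gamma_gt0 // a0 ltW.
have cq0 : 0 < c * q `^ alpha by rewrite mulr_gt0 // powR_gt0.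
rewrite aging_density_laplace_tail //.
set L := (X in X = _); have L0 : (0 <= L)%E.
  by apply: integral_ge0 => w _; rewrite lee_fin expR_ge0.
pose f (z : R * T) := (expR (- (q * Num.max 0 (H z.2))) *
  expR (- (q * Num.max 0 (restart A D t0 z.2 (Some (false, z.1)))))) : R.
have mH := measurable_overshoot levyA stableD t0.
have mexp d' (T' : measurableType d') (g : T' -> R) : measurable_fun setT g ->
    measurable_fun setT (fun x => expR (- (q * Num.max 0 (g x)))).
  move=> mg; apply: measurableT_comp => //; apply: measurable_funN.
  by apply: measurable_funM => //; exact: measurable_maxr.
have mf : measurable_fun setT f.
  apply: measurable_funM; apply: mexp; last exact: measurable_after_passage.
  exact: measurableT_comp.
have mint : measurable_fun setT (fun w => \int[mu]_(s in pos) (f (s, w))%:E)%E.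
  apply: (@measurable_integral_setX _ _ _ lebesgue_measure _ _ pos setT
    (fun z => (f z)%:E)) => //.
  - by apply/measurable_EFinP; exact: measurable_funTS.
  - by move=> z _; rewrite lee_fin mulr_ge0 ?expR_ge0.
(* Two evaluations of the integral of E[e^(-q D_s) ; D_s > t_0] over s > 0: by the potential
   density, and by restarting at the passage. *)
have key : (((c * gamma_function alpha)^-1)%:E *
    \int[mu]_(x in `]t0, +oo[) (x `^ (alpha - 1) * expR (- (q * x)))%:E =
    (expR (- (q * t0)))%:E * (L * ((c * q `^ alpha)^-1)%:E))%E.
  rewrite -(potential_tail alpha01 c_gt0 levyA stableD t0_gt0 q0).
  rewrite (@tonelli_on _ _ _ lebesgue_measure _ _ P pos setT (fun z =>
    (expR (- (q * truncated D z)) * (t0 < truncated D z)%R%:R)%:E)) //; last first.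
    by apply/measurable_EFinP; exact: (measurable_truncated_tail levyA stableD).
  transitivity (\int[P]_w ((expR (- (q * t0)))%:E * \int[mu]_(s in pos) (f (s, w))%:E))%E.
    apply: ge0_ae_eq_integral => //.
    - apply: (@measurable_integral_setX _ _ _ lebesgue_measure _ _ pos setT (fun z =>
        (expR (- (q * truncated D z)) * (t0 < truncated D z)%R%:R)%:E)) => //.
      apply/measurable_EFinP; exact: (measurable_truncated_tail levyA stableD).
    - exact: emeasurable_funM.
    - by move=> w _; apply: integral_ge0 => s _; rewrite lee_fin mulr_ge0 ?expR_ge0.
    - move=> w _; rewrite mule_ge0 ?lee_fin ?expR_ge0 //.
      by apply: integral_ge0 => s _; rewrite lee_fin mulr_ge0 ?expR_ge0.
    - by apply: filterS rae => w rw _; exact: passage_integral.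
  rewrite ge0_integralZl_EFin ?expR_ge0 //; last first.
    by move=> w _; apply: integral_ge0 => s _; rewrite lee_fin mulr_ge0 ?expR_ge0.
  congr (_ * _)%E.
  rewrite -(@tonelli_on _ _ _ lebesgue_measure _ _ P pos setT (fun z => (f z)%:E)) //; last first.
  - by move=> z _; rewrite lee_fin mulr_ge0 ?expR_ge0.
  - by apply/measurable_EFinP; exact: measurable_funTS.
  transitivity (\int[mu]_(s in pos) (L * (expR (- ((c * q `^ alpha) * s)))%:E))%E.
    apply: eq_integral => s /set_mem /in_pos s0.
    by rewrite restart_laplace ?ltW // [s * c]mulrC mulrAC.
  rewrite ge0_integralZl //; last first.
    apply/measurable_EFinP; apply: measurable_funTS; apply: measurableT_comp => //.
    by apply: measurable_funN; exact: measurable_funM.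
  by rewrite integral_expR.
have Lfin : L \is a fin_num.
  rewrite ge0_fin_numE //; apply: (@le_lt_trans _ _ (\int[P]_w (cst 1%:E w))%E).
    apply: ge0_le_integral => //.
    - by apply/measurable_EFinP; exact: mexp.
    - move=> w _; rewrite lee_fin expR_le1 oppr_le0 (mulr_ge0 (ltW q0)) //.
      by rewrite le_max lexx.
  rewrite integral_cst // mul1e.
  exact: le_lt_trans (probability_le1 P measurableT) (ltry 1).
rewrite (_ : (\int[mu]_(x in _) _)%E = ((expR (q * t0))%:E *
    \int[mu]_(x in `]t0, +oo[) (x `^ (alpha - 1) * expR (- (q * x)))%:E)%E); last first.
  rewrite -ge0_integralZl_EFin ?expR_ge0 //; last 2 first.
  - by move=> x _; rewrite lee_fin mulr_ge0 ?powR_ge0 ?expR_ge0.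
  - by apply/measurable_EFinP; exact: measurable_pow_exp.
  apply: eq_integral => x _; rewrite -EFinM mulrCA -expRD; congr (_ * expR _)%:E.
  by ring.
move: key; set J := integral _ _ _ => key.
rewrite -(fineK Lfin) in key *; set l := fine L in key *.
(* J is not known to be finite; in this form [key] replaces it by a real number, and c cancels. *)
have -> : J = ((c * gamma_function alpha)%:E *
    (((c * gamma_function alpha)^-1)%:E * J))%E.
  by rewrite muleA -EFinM mulfV ?mul1e // gt_eqF // mulr_gt0.
rewrite key -!EFinM expRN; congr _%:E; field.
by rewrite !gt_eqF ?expR_gt0 // powR_gt0.
Qed.

End overshoot_law.

(** * The inverse of a path before and after the overshoot *)

Section inverse_restart.
Context {R : realType}.
Variables (f : R -> R) (t0 : R).
Hypothesis f_right : forall t, 0 <= t -> f s @[s --> t^'+] --> f t.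
Hypothesis f_nd : forall s t, 0 <= s -> s <= t -> f s <= f t.
Hypothesis f_unbounded : forall M, exists i : nat, M < f i%:R.
Local Notation e0 := (ginv f t0).

(** The path jumps over these levels at [e0], so its inverse is constant on them. *)
Lemma ginv_before_overshoot u : t0 <= u -> u < f e0 -> ginv f u = e0.
Proof.
move=> t0u ue; apply: ginvE => //; first exact: ginv_ge0.
by move=> x x0 xe; apply: le_trans t0u; exact: lt_ginv.
Qed.

Lemma cvg_right_shift (g : R -> R) (e t : R) : 0 <= t ->
  g s @[s --> (e + t)^'+] --> g (e + t) ->
  g (e + `|s|) @[s --> t^'+] --> g (e + `|t|).
Proof.
move=> t_ge0 gr; rewrite (ger0_norm t_ge0).
apply/cvgrPdist_lt => eps eps0.
move/cvgrPdist_lt : gr => /(_ eps eps0) [r /= r0 rP].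
exists r => // s /= sr ts.
have s0 : 0 <= s by exact: le_trans t_ge0 (ltW ts).
rewrite (ger0_norm s0); apply: rP; last by rewrite ltrD2l.
by rewrite /= opprD addrACA subrr add0r.
Qed.

Lemma cvg_right_norm (g : R -> R) (t : R) : 0 <= t ->
  g s @[s --> t^'+] --> g t -> g `|s| @[s --> t^'+] --> g `|t|.
Proof.
move=> t_ge0 gr; have := @cvg_right_shift g 0 t t_ge0.
rewrite !add0r => /(_ gr).
by rewrite (_ : (fun s => g (0 + `|s|)) = fun s => g `|s|) //;
  apply/funext => s; rewrite add0r.
Qed.

(** A level u >= f e_0 is exceeded only after e_0, and there f exceeds u when the restarted path
    exceeds u - f e_0. As an infimum may not be attained, each strict inequality is refuted at a
    point strictly between. *)
Lemma ginv_after_overshoot u : f e0 <= u ->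
  ginv f u = e0 + ginv (fun s => f (e0 + `|s|) - f e0) (u - f e0).
Proof.
move=> eu; set g := fun s => _; have e0_ge0 : 0 <= e0 := ginv_ge0 f t0.
have g_right t : 0 <= t -> g s @[s --> t^'+] --> g t.
  move=> t_ge0; apply: cvgB; last exact: cvg_cst.
  by apply: cvg_right_shift => //; apply: f_right; rewrite addr_ge0.
have g_nd s t : 0 <= s -> s <= t -> g s <= g t.
  move=> s0 st; rewrite lerD2r f_nd ?addr_ge0 //.
  by rewrite !ger0_norm ?(le_trans s0 st) // lerD2l.
have g_unb M : exists i : nat, M < g i%:R.
  have [i Mi] := f_unbounded (M + f e0); exists i.
  rewrite ltrBrDr (lt_le_trans Mi) // f_nd // ger0_norm // lerDr //.
apply/eqP; rewrite eq_le; apply/andP; split; rewrite leNgt; apply/negP => lt.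
- set e := ginv g _ in lt.
  have [s es seu] : exists2 s, e < s & e0 + s < ginv f u.
    by exists ((e + (ginv f u - e0)) / 2); lra.
  have s0 : 0 <= s by apply: le_trans (ltW es); exact: ginv_ge0.
  have := ginv_lt g_nd g_unb es; rewrite /g ltrD2r ger0_norm // => us.
  by have := ginv_le (addr_ge0 e0_ge0 s0) us; rewrite leNgt seu.
- set e := ginv g _ in lt.
  have [s us se] : exists2 s, ginv f u < s & s < e0 + e.
    by exists ((ginv f u + (e0 + e)) / 2); lra.
  have ufs := ginv_lt f_nd f_unbounded us.
  have s0 : 0 <= s by apply: le_trans (ltW us); exact: ginv_ge0.
  have e0s : e0 <= s.
    rewrite leNgt; apply/negP => /ltW /(f_nd s0).
    by rewrite leNgt (le_lt_trans eu).
  have : e <= s - e0.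
    apply: ginv_le; first by rewrite subr_ge0.
    by rewrite /g ger0_norm ?subr_ge0 // (addrC e0) subrK ltrD2r.
  by rewrite leNgt ltrBlDl se.
Qed.

End inverse_restart.

(** * Density of the overshoot *)

Section overshoot_density.
Context d (T : measurableType d) (R : realType) (P : probability T R).
Variables (alpha c : R) (A D : R -> {RV P >-> R}).
Hypotheses (alpha01 : 0 < alpha < 1) (c_gt0 : 0 < c) (levyA : levy_process A).
Hypothesis stableD : stable_subordinator alpha c D.
Hypothesis indepAD : independent_processes A D.
Variable t0 : R.
Hypothesis t0_gt0 : 0 < t0.
Local Notation mu := (@lebesgue_measure R).
Local Notation pos := (`]0, +oo[%classic : set R).
Local Notation H := (overshoot D t0).
Local Notation p := (aging_density alpha t0).

Let rae := regular_path_ae c_gt0 levyA stableD.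

Let mH := measurable_overshoot levyA stableD t0.

Let mHp : measurable_fun setT (fun w => Num.max 0 (H w)).
Proof. exact: measurable_maxr. Qed.

Let p0 x : pos x -> 0 <= p x.
Proof. by move=> /in_pos x0; exact: aging_density_ge0. Qed.

(** Moments of e^(-H) with weight 1: for n >= 1 they are values of the Laplace transform at q = n,
    and for n = 0 both masses are 1. The maximum with 0 keeps e^(-H) in [0, 1] on all paths. *)
Lemma overshoot_tail x :
  (P [set w | x < Num.max 0 (H w)]%R = \int[mu]_(r in `]x, +oo[ `&` pos) (p r)%:E)%E.
Proof.
have total := aging_density_total alpha01 t0_gt0.
have mp := @measurable_aging_density R alpha t0 t0_gt0.
have := @moment_uniqueness R _ _ P _ _ lebesgue_measure setT pos (cst 1)
  (fun w => expR (- Num.max 0 (H w))) p (fun r => expR (- r)).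
move=> /(_ _ _ _ _ _ _ _ _ _ _ _ _ (expR (- x)) (expR_gt0 _)) LU.
have {}LU : (\int[P]_w (cst 1 w * (expR (- Num.max 0 (H w)) < expR (- x))%R%:R)%:E =
    \int[mu]_(r in pos) (p r * (expR (- r) < expR (- x))%R%:R)%:E)%E.
  apply: LU => //.
  - apply: measurableT_comp => //; exact: measurable_funN.
  - by apply: measurable_funTS; apply: measurableT_comp => //; exact: measurable_funN.
  - by move=> w _; rewrite expR_ge0 expR_le1 oppr_le0 le_max lexx.
  - by move=> r /in_pos r0; rewrite expR_ge0 expR_le1 oppr_le0 ltW.
  - rewrite -[X in (X < _)%E]/(\int[P]_w (cst 1%E w))%E integral_cst // mul1e.
    exact: le_lt_trans (probability_le1 P measurableT) (ltry 1).
  - case=> [|n].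
      transitivity (\int[P]_w (cst 1%E w))%E.
        by apply: eq_integral => w _; rewrite expr0 mulr1.
      rewrite integral_cst // mul1e; transitivity (1 : \bar R)%E.
        exact: probability_setT.
      rewrite -total; apply: eq_integral => r _.
      by rewrite expr0 mulr1.
    have := overshoot_laplace alpha01 c_gt0 levyA stableD indepAD t0_gt0 (ltr0Sn R n).
    move=> h; transitivity (\int[P]_w (expR (- (n.+1%:R * Num.max 0 (H w))))%:E)%E.
      by apply: eq_integral => w _; rewrite mul1r -expRM_natl mulrN.
    rewrite h; apply: eq_integral => r _.
    by rewrite mulrC -expRM_natl mulrN.
transitivity (\int[P]_w (\1_([set w | x < Num.max 0 (H w)]%R) w)%:E)%E.
  rewrite integral_indic ?setIT //; exact: measurable_set_lt.
transitivity (\int[P]_w (cst 1 w * (expR (- Num.max 0 (H w)) < expR (- x))%R%:R)%:E)%E.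
  by apply: eq_integral => w _; rewrite mul1r ltr_expR ltrN2 indicE mem_setE.
rewrite LU [RHS]integral_mkcond [LHS]integral_mkcond; apply: eq_integral => r _.
rewrite !patchE in_setI !mem_setE !in_itv /= !andbT ltr_expR ltrN2.
by case: (x < r); case: (0 < r) => //=; rewrite ?mulr1 ?mulr0.
Qed.

(** Half-lines are closed under intersection and generate the Borel sets; the total mass 1 of the
    density gives stability under complement. *)
Lemma overshoot_density (C : set R) : measurable C ->
  (P [set w | C (H w)] = \int[mu]_(r in C `&` pos) (p r)%:E)%E.
Proof.
have mp := @measurable_aging_density R alpha t0 t0_gt0.
have mpI (S : set R) : measurable_fun (S `&` pos) (EFin \o p).
  by apply/measurable_EFinP; apply: measurable_funS mp => // r [].
have mpre (S : set R) : measurable S -> measurable [set w | S (Num.max 0 (H w))].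
  by move=> mS; rewrite -[X in measurable X]setTI; exact: mHp.
have pI0 (S : set R) r : (S `&` pos) r -> (0 <= (p r)%:E)%E.
  by move=> [_ /p0]; rewrite lee_fin.
move=> mC; transitivity (P [set w | C (Num.max 0 (H w))]%R).
  have mCH : measurable [set w | C (H w)].
    by rewrite -[X in measurable X]setTI; exact: mH.
  apply: ae_eq_probability => //; first exact: mpre.
  by apply: filterS rae => w rw /=; rewrite max_r //; exact: (overshoot_ge0 levyA stableD t0 rw).
have sC : (@RGenOInfty.G R).-sigma.-measurable C.
  by rewrite -RGenOInfty.measurableE; exact: mC.
move: C sC {mC}; apply: (@dynkin_induction _ R (@RGenOInfty.G R) (fun C =>
  (P [set w | C (Num.max 0 (H w))]%R = \int[mu]_(r in C `&` pos) (p r)%:E)%E)).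
- exact: RGenOInfty.measurableE.
- move=> _ _ [x ->] [y ->]; exists (Num.max x y).
  by apply/seteqP; split=> z /=; rewrite !in_itv /= !andbT gt_max => /andP.
- rewrite setTI aging_density_total // -(probability_setT P).
  by congr (P _); apply/seteqP; split.
- by move=> _ [x ->]; rewrite -overshoot_tail;
    congr (P _); apply/seteqP; split=> w /=; rewrite in_itv andbT.
- move=> S mS SE.
  have : (\int[mu]_(r in pos) (p r)%:E = \int[mu]_(r in S `&` pos) (p r)%:E +
      \int[mu]_(r in ~` S `&` pos) (p r)%:E)%E.
    have posE : S `&` pos `|` ~` S `&` pos = pos by rewrite -setIUl setUv setTI.
    rewrite -{1}posE ge0_integral_setU //=.
    - by apply: measurableI => //; exact: measurable_itv.
    - by apply: measurableI; [exact: measurableC|exact: measurable_itv].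
    - by rewrite posE; apply/measurable_EFinP.
    - by move=> r [] [_ /p0]; rewrite lee_fin.
    - by apply/disj_setPS => r [[Sr _] [nSr _]].
  rewrite aging_density_total // -SE => tot.
  rewrite -[LHS]/(P (~` [set w | S (Num.max 0 (H w))])) probability_setC; last exact: (mpre S mS).
  by rewrite tot addeAC subee ?add0e // fin_num_measure //; exact: (mpre S mS).
- move=> F mF tF FE.
  rewrite (_ : [set w | _] = \bigcup_k [set w | F k (Num.max 0 (H w))]) //.
  rewrite measure_bigcup //; last 2 first.
  - by move=> k _; exact: mpre.
  - by move=> i j _ _ [w [Fi Fj]]; apply: (tF i j I I); exists (Num.max 0 (H w)).
  rewrite setI_bigcupl ge0_integral_bigcup //; last 4 first.
  - by move=> k; apply: measurableI; [exact: mF|exact: measurable_itv].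
  - by rewrite -setI_bigcupl; exact: mpI.
  - by move=> r; rewrite -setI_bigcupl; exact: pI0.
  - exact: trivIset_setIr.
  transitivity (\sum_(k <oo) P [set w | F k (Num.max 0 (H w))]%R)%E.
    by apply: eq_eseriesl => k; rewrite in_setT.
  by apply: eq_eseriesr => k _; exact: FE.
Qed.

End overshoot_density.

(** * The aging process *)

Section aging_process.
Context d (T : measurableType d) (R : realType) (P : probability T R).
Variables (alpha c : R) (A D : R -> {RV P >-> R}).
Hypotheses (alpha01 : 0 < alpha < 1) (c_gt0 : 0 < c) (levyA : levy_process A).
Hypothesis stableD : stable_subordinator alpha c D.
Hypothesis indepAD : independent_processes A D.
Variable t0 : R.
Hypothesis t0_gt0 : 0 < t0.
Local Notation mu := (@lebesgue_measure R).
Local Notation pos := (`]0, +oo[%classic : set R).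
Local Notation H := (overshoot D t0).
Local Notation E := (passage_time D t0).
Local Notation Y := (time_changed A D).

Let Aright w t : 0 <= t -> A s w @[s --> t^'+] --> A t w.
Proof. exact: (@pair_process_right _ _ _ _ alpha c A D levyA stableD true). Qed.

Let Dright w t : 0 <= t -> D s w @[s --> t^'+] --> D t w.
Proof. exact: (@pair_process_right _ _ _ _ alpha c A D levyA stableD false). Qed.

Lemma measurable_time_changed d' (T' : measurableType d') (tau : T' -> R) (h : T' -> T) :
  measurable_fun setT tau -> measurable_fun setT h ->
  measurable_fun setT (fun z => Y (tau z) (h z)).
Proof.
move=> mtau mh.
apply: (@measurable_eval _ _ T' (fun s z => A s (h z))
  (fun z => ginv (D ^~ (h z)) (tau z))).
- by move=> z t t_ge0; exact: Aright.
- by move=> s _; exact: measurableT_comp.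
- apply: (@measurable_ginv _ _ T' (fun s z => D s (h z)) tau) => //.
    by move=> z t t_ge0; exact: Dright.
  by move=> s _; exact: measurableT_comp.
- by move=> z; exact: ginv_ge0.
Qed.

(* The first component [None] of the path is the overshoot; the aging process
   is the process time-changed along the restarted path, delayed by it. *)
Definition path_time_changed (v : option (bool * R) -> R) (t : R) : R :=
  grid_time_change (fun s => v (Some (true, s))) (fun s => v (Some (false, s)))
    (t - v None).

Lemma path_time_changed_fresh w w' t :
  path_time_changed (fresh A D t0 w w') t = Y (t - H w) w'.
Proof.
rewrite /path_time_changed /fresh /= grid_time_changeE.
- have -> : ginv (fun s => D `|s| w') (t - H w) = ginv (D ^~ w') (t - H w).
    rewrite /ginv; congr inf; apply/seteqP; split=> s /= [s0];
      by rewrite (ger0_norm s0).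
  by rewrite ger0_norm // ginv_ge0.
- by move=> s s0; apply: (@cvg_right_norm _ (A ^~ w')) => //; exact: Aright.
- by move=> s s0; apply: (@cvg_right_norm _ (D ^~ w')) => //; exact: Dright.
Qed.

(** Once t + t_0 has reached D_E, its inverse is E plus the inverse of the restarted path at t + t_0
    - D_E = t - H. *)
Lemma path_time_changed_restart w t : regular_path A D w -> 0 <= t -> H w <= t ->
  path_time_changed (restart A D t0 w) t = aging Y t0 t w.
Proof.
move=> [_ D0 Dnd Du] t_ge0 Ht.
have E0 := passage_time_ge0 D t0 w.
rewrite /path_time_changed /= grid_time_changeE; last 2 first.
- move=> s s0; apply: cvgB; last exact: cvg_cst.
  apply: (@cvg_right_shift _ (fun x => A x w)) => //.
  by apply: Aright; rewrite addr_ge0.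
- move=> s s0; apply: cvgB; last exact: cvg_cst.
  apply: (@cvg_right_shift _ (fun x => D x w)) => //.
  by apply: Dright; rewrite addr_ge0.
rewrite /aging /time_changed /inverse_subordinator.
rewrite -[X in _ = A X w - _]/(ginv (D ^~ w) (t + t0)).
rewrite (@ginv_after_overshoot _ (D ^~ w) t0) //; last 2 first.
- by move=> s s0; exact: Dright.
- by move: Ht; rewrite /overshoot lerBlDr.
rewrite ger0_norm ?ginv_ge0 //.
by congr (A (_ + ginv _ _) w - _); rewrite /overshoot opprB addrA.
Qed.

Lemma aging_before_overshoot w t : regular_path A D w -> 0 <= t -> t < H w ->
  aging Y t0 t w = 0.
Proof.
move=> [_ D0 Dnd Du] t_ge0 tH; rewrite /aging /time_changed /inverse_subordinator.
rewrite -[X in A X w - _ = _]/(ginv (D ^~ w) (t + t0)).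
rewrite (@ginv_before_overshoot _ (D ^~ w) t0) ?subrr //.
- by rewrite lerDr.
- by move: tH; rewrite /overshoot ltrBrDr.
Qed.

(** * Finite-dimensional laws of the aging process *)

Section finite_dimensional.
Variables (k : nat) (k_ge1 : (1 <= k)%N).
Variable B : 'I_k -> set (measurableTypeR R).
Hypothesis mB : forall i, measurable (B i).
Hypothesis B1_0 : ~ B (Ordinal k_ge1) 0.
Variable t : 'I_k -> R.
Hypothesis t1_gt0 : 0 < t (Ordinal k_ge1).
Hypothesis t_incr : forall i j : 'I_k, (i < j)%N -> t i < t j.
Local Notation t1 := (t (Ordinal k_ge1)).

Let t1_le i : t1 <= t i.
Proof.
have [->//|i0] := eqVneq i (Ordinal k_ge1).
apply/ltW/t_incr => /=; rewrite lt0n; apply: contra_neq i0 => i0.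
exact: val_inj.
Qed.

Lemma measurable_forall_ord d' (T' : measurableType d') (g : 'I_k -> T' -> R) :
  (forall i, measurable_fun setT (g i)) ->
  measurable [set z | forall i, B i (g i z)].
Proof.
move=> mg; rewrite (_ : mkset _ = \bigcap_(i in [set: 'I_k]) (g i @^-1` B i)).
  apply: fin_bigcap_measurable => [|i _]; first exact: finite_finset.
  by rewrite -[X in measurable X]setTI; exact: (mg i measurableT _ (mB i)).
by apply/seteqP; split=> z /= h i; [move=> _|]; exact: h.
Qed.

(** The event under the integral, joint in the delay and the path, with the range of integration
    included. *)
Let Q : set (R * T) := [set z | z.1 <= t1] `&`
  [set z | forall i, B i (Y (t i - z.1) z.2)].

Let mQ : measurable Q.
Proof.
apply: measurableI; first exact: measurable_set_le.
apply: measurable_forall_ord => i; apply: measurable_time_changed => //.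
exact: measurable_funB.
Qed.

Let mH := measurable_overshoot levyA stableD t0.

Let mHQ : measurable [set z : T * T | Q (H z.1, z.2)].
Proof.
rewrite -[X in measurable X]setTI.
apply: (_ : measurable_fun setT (fun z : T * T => (H z.1, z.2))) => //.
by apply: measurable_fun_pair => //; exact: measurableT_comp.
Qed.

(** On regular paths the aging event is an event on the restarted family, to which [restart_law]
    applies. *)
Lemma aging_restart_law : P [set w | forall i, B i (aging Y t0 (t i) w)] =
  (P \x P)%E [set z | Q (H z.1, z.2)].
Proof.
pose I := option (bool * R).
pose W : measurableType _ := g_sigma_algebraType (@cylinders R I).
pose S : set (I -> R) := [set v | v None <= t1] `&`
  [set v | forall i, B i (path_time_changed v (t i))].
have mcoord (o : I) : measurable_fun setT (fun v : W => (v : I -> R) o).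
  exact: measurable_coordinate.
have mS : <<s cylinders >> S.
  suff : measurable (S : set W) by [].
  apply: measurableI; first exact: measurable_set_le.
  apply: (@measurable_forall_ord _ W (fun i v => path_time_changed v (t i))) => i.
  apply: (@measurable_grid_time_change _ _ W
    (fun s v => (v : I -> R) (Some (true, s)))
    (fun s v => (v : I -> R) (Some (false, s)))
    (fun v => t i - (v : I -> R) None)) => //.
  exact: measurable_funB.
transitivity (P (restart A D t0 @^-1` S)).
  apply: ae_eq_probability.
  - apply: measurable_forall_ord => i; apply: measurable_funB;
      exact: (@measurable_time_changed _ T _ id).
  - exact: (measurable_preimage_cylinders (measurable_restart levyA stableD t0) mS).
  apply: filterS (regular_path_ae c_gt0 levyA stableD) => w rw; split => /=.
    move=> Bw; have Ht1 : H w <= t1.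
      rewrite leNgt; apply/negP => t1H; apply: B1_0.
      by have := Bw (Ordinal k_ge1); rewrite aging_before_overshoot // ltW.
    split => // i; rewrite path_time_changed_restart //.
      by rewrite (le_trans (ltW t1_gt0)).
    by rewrite (le_trans Ht1).
  move=> [Ht1 Bw] i; rewrite -path_time_changed_restart //.
    by rewrite (le_trans (ltW t1_gt0)).
  by rewrite (le_trans Ht1).
rewrite (restart_law c_gt0 levyA stableD indepAD (ltW t0_gt0)) //.
congr (_ _); apply/seteqP; split=> -[w w'] [/= Ht1 Bw]; split => // i.
  by rewrite -path_time_changed_fresh.
by rewrite path_time_changed_fresh.
Qed.

Lemma aging_finite_dimensional :
  P [set w | forall i, B i (aging Y t0 (t i) w)] =
  (\int[lebesgue_measure]_(r in `]0%R, t1])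
     (P [set w | forall i, B i (Y (t i - r)%R w)] *
      (aging_density alpha t0 r)%:E))%E.
Proof.
have mp := @measurable_aging_density R alpha t0 t0_gt0.
have p0 r : 0 < r -> 0 <= aging_density alpha t0 r by exact: aging_density_ge0.
have mQr r : measurable [set w | Q (r, w)].
  rewrite -[X in measurable X]setTI.
  by apply: (_ : measurable_fun setT (fun w : T => (r, w))) => //; exact: pair1_measurable.
have mQw w : measurable [set r | Q (r, w)].
  rewrite -[X in measurable X]setTI.
  by apply: (_ : measurable_fun setT (fun r : R => (r, w))) => //; exact: pair2_measurable.
rewrite aging_restart_law.
(* The fresh path w' is outermost: for fixed w' the inner integral is the probability that H lies in
   a section of Q, an integral of the density. *)
transitivity (\int[P]_w' \int[P]_w (\1_[set z : T * T | Q (H z.1, z.2)] (w, w'))%:E)%E.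
  rewrite -[X in (P \x P)%E X]setIT -integral_indic //.
  rewrite -(@fubini_tonelli _ _ _ _ _ P P (EFin \o \1_[set z : T * T | Q (H z.1, z.2)])) //.
  - by rewrite fubini_tonelli1 //; apply/measurable_EFinP; exact: measurable_indic.
  - by apply/measurable_EFinP; exact: measurable_indic.
  - by move=> z; rewrite lee_fin.
pose f (z : R * T) : \bar R := (\1_Q z * aging_density alpha t0 z.1)%:E.
have mf : measurable_fun (pos `*` setT) f.
  apply/measurable_EFinP; apply: measurable_funM.
    by apply: measurable_funTS; exact: measurable_indic.
  apply: (@measurable_comp _ _ _ _ _ _ pos) => //.
  - by move=> _ [[r w] [/= r0 _] <-].
  - by apply: measurable_funTS; exact: measurable_fst.
transitivity (\int[P]_w' \int[mu]_(r in pos) f (r, w'))%E.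
  apply: eq_integral => w' _.
  transitivity (P [set w | [set r | Q (r, w')] (H w)]).
    rewrite -[X in P X]setIT -integral_indic //.
    rewrite -[X in measurable X]setTI; exact: mH.
  rewrite (overshoot_density alpha01 c_gt0 levyA stableD indepAD t0_gt0 (mQw w')).
  rewrite [RHS]integral_mkcond [LHS]integral_mkcond; apply: eq_integral => r _.
  rewrite !patchE in_setI /f indicE /=.
  have -> : ((r, w') \in Q) = (r \in [set r | Q (r, w')]) by apply/idP/idP; rewrite !inE.
  by case: (r \in _); case: (r \in _); rewrite /= ?mul1r ?mul0r.
rewrite -(@tonelli_on _ _ _ lebesgue_measure _ _ P pos setT f) //; last first.
  by move=> [r w] [/in_pos r0 _]; rewrite lee_fin mulr_ge0 ?p0.
rewrite [RHS]integral_mkcond [LHS]integral_mkcond; apply: eq_integral => r _.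
rewrite !patchE !mem_setE !in_itv /= andbT.
have [r0|r0] := boolP (0 < r); last by [].
(* The condition r <= t_1 in Q cuts the domain from ]0, +oo[ down to ]0, t_1]. *)
have [rt1|rt1] := boolP (r <= t1); last first.
  rewrite /=; under eq_integral => w _.
    rewrite /f indicE memNset ?mul0r; last by move=> [/= rt1' _]; rewrite rt1' in rt1.
    over.
  by rewrite integral0.
have -> : P [set w | forall i, B i (Y (t i - r) w)] = (\int[P]_w (\1_Q (r, w))%:E)%E.
  rewrite -[X in P X]setIT -integral_indic //; last first.
    apply: measurable_forall_ord => i.
    exact: (@measurable_time_changed _ T (fun=> t i - r) id).
  apply: eq_integral => w _; rewrite !indicE.
  have -> // : (w \in [set w | forall i, B i (Y (t i - r) w)]) = ((r, w) \in Q).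
  by apply/idP/idP; rewrite !inE; [split|case].
rewrite /= -ge0_integralZr //; last 2 first.
- apply/measurable_EFinP.
  by apply: (@measurable_fun_pair2 _ _ _ _ _ _ (\1_Q : R * T -> R)); exact: measurable_indic.
- by rewrite lee_fin p0.
Qed.

End finite_dimensional.
End aging_process.

Theorem theorem1 (d : measure_display) (T : measurableType d) (R : realType)
    (P : probability T R) (alpha c : R) (A D : R -> {RV P >-> R})
    (alpha_gt0 : 0 < alpha) (alpha_lt1 : alpha < 1) (c_gt0 : 0 < c)
    (levyA : levy_process A) (stableD : stable_subordinator alpha c D)
    (indepAD : independent_processes A D)
    (t0 : R) (t0_gt0 : 0 < t0)
    (k : nat) (k_ge1 : (1 <= k)%N)
    (B : 'I_k -> set (measurableTypeR R)) (mB : forall i, measurable (B i))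
    (B1_0 : ~ B (Ordinal k_ge1) 0)
    (t : 'I_k -> R) (t1_gt0 : 0 < t (Ordinal k_ge1))
    (t_incr : forall i j : 'I_k, (i < j)%N -> t i < t j) :
  let Y := time_changed A D in
  P [set w | forall i, B i (aging Y t0 (t i) w)] =
  (\int[lebesgue_measure]_(r in `]0%R, t (Ordinal k_ge1)])
     (P [set w | forall i, B i (Y (t i - r)%R w)] *
      (aging_density alpha t0 r)%:E))%E.
Proof.
move=> Y; have alpha01 : 0 < alpha < 1 by rewrite alpha_gt0.
exact: (aging_finite_dimensional alpha01 c_gt0 levyA stableD indepAD t0_gt0 mB B1_0
  t1_gt0 t_incr).
Qed.
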